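(* Let $A,Q\in\mathbb{R}^{n\times n}$ satisfy the structural stability condition in the normalized form described in the context and assume $\det(A)\neq0$. For $\epsilon>0$ let $\epsilon(x)=1$ for $x\le 0$ and $\epsilon(x)=\epsilon$ for $x>0$. If $U_0\in H^1(\mathbb{R})$, then there exists a solution $U^\epsilon=U^\epsilon(x,t)$ of the initial-value problem $$U_t+AU_x=\frac{1}{\epsilon(x)}QU,\quad x\in\mathbb{R},\ t>0,\qquad U(x,0)=U_0(x),$$ which satisfies $$\|U^\epsilon(\cdot,t)\|_{L^2(\mathbb{R})}\le \|U^\epsilon(\cdot,0)\|_{L^2(\mathbb{R})}$$ for every $\epsilon>0$ and every $t>0$.
   Context: Structural stability condition (normalized form used throughout the paper): $A$ is symmetric and $Q=\mathrm{diag}(0_{(n-m)\times(n-m)},S)$ with $S\in\mathbb{R}^{m\times m}$ symmetric negative definite. Solutions are understood in the weak sense: $\int_0^T\int_{\mathbb{R}}[\phi_t^TU+\phi_x^TAU+\epsilon(x)^{-1}\phi^TQU]\,dx\,dt=0$ for all test functions $\phi$ compactly supported in $\{t>0\}$ (with the initial condition). *)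

(* Defs.v *)
From HB Require Import structures.
From mathcomp Require Import all_boot all_order all_algebra.
From mathcomp Require Import all_classical all_reals all_analysis.
Set Implicit Arguments. Unset Strict Implicit. Unset Printing Implicit Defensive.
Import Order.TTheory GRing.Theory Num.Theory.
Import numFieldNormedType.Exports.
Local Open Scope classical_set_scope.
Local Open Scope ring_scope.

Section Defs.
Context {R : realType}.
Notation leb := (@lebesgue_measure R).

Definition sq_integrable (f : R -> R) : Prop :=
  measurable_fun setT f /\ (\int[leb]_x ((f x ^+ 2)%:E) < +oo)%E.

Definition test_fun1 (f : R -> R) : Prop :=
  (forall (k : nat) (x : R), derivable (derive1n k f) x 1) /\
  (exists M : R, forall x, M < `|x| -> f x = 0).

Definition weak_deriv1 (u g : R -> R) : Prop :=
  forall phi, test_fun1 phi ->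
    Rintegral leb setT (fun x => u x * derive1 phi x)
    = - Rintegral leb setT (fun x => g x * phi x).

Definition H1 (u : R -> R) : Prop :=
  sq_integrable u /\ exists g, sq_integrable g /\ weak_deriv1 u g.

Definition H1vec (n : nat) (U0 : R -> 'cV[R]_n) : Prop :=
  forall i : 'I_n, H1 (fun x => U0 x i 0).

Definition partial_x (f : R -> R -> R) : R -> R -> R :=
  fun x t => derive1 (fun y => f y t) x.
Definition partial_t (f : R -> R -> R) : R -> R -> R :=
  fun x t => derive1 (fun s => f x s) t.

Definition iter_partial (s : seq bool) (f : R -> R -> R) : R -> R -> R :=
  foldr (fun (b : bool) g => if b then partial_t g else partial_x g) f s.

Definition smooth2 (f : R -> R -> R) : Prop :=
  forall s : seq bool,
    continuous (fun p : R * R => iter_partial s f p.1 p.2) /\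
    (forall x t, derivable (fun y => iter_partial s f y t) x 1) /\
    (forall x t, derivable (fun u => iter_partial s f x u) t 1).

Definition test_fun2 (n : nat) (phi : 'I_n -> R -> R -> R) : Prop :=
  (forall i, smooth2 (phi i)) /\
  (exists M : R, forall i x t, (M < `|x| \/ M < `|t|) -> phi i x t = 0).

Definition loc_integrable_half (n : nat) (U : R -> R -> 'cV[R]_n) : Prop :=
  (forall i : 'I_n, measurable_fun setT (fun p : R * R => U p.1 p.2 i 0)) /\
  (forall (M : R) (i : 'I_n),
     (leb \x leb)%E.-integrable
        ([set x | `|x| <= M] `*` [set t | 0 <= t <= M])
        (fun p : R * R => (U p.1 p.2 i 0)%:E)).

(** weak solution of U_t + A U_x = eps(x)^-1 Q U, U(x,0) = U0(x), on t >= 0.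
    U x t is the value at (x,t). *)
Definition weak_solution (n : nat) (A Q : 'M[R]_n) (eps : R -> R)
    (U0 : R -> 'cV[R]_n) (U : R -> R -> 'cV[R]_n) : Prop :=
  loc_integrable_half U /\
  (forall x, U x 0 = U0 x) /\
  forall phi : 'I_n -> R -> R -> R, test_fun2 phi ->
    Rintegral (leb \x leb)%E (setT `*` [set t | 0 <= t])
      (fun p : R * R =>
         let x := p.1 in let t := p.2 in
         (((\col_i partial_t (phi i) x t)^T *m U x t) 0 0
          + ((\col_i partial_x (phi i) x t)^T *m A *m U x t) 0 0
          + (eps x)^-1 * ((\col_i phi i x t)^T *m Q *m U x t) 0 0))
    + Rintegral leb setT (fun x => ((\col_i phi i x 0)^T *m U0 x) 0 0) = 0.

Definition eps_fun (e : R) (x : R) : R := if x <= 0 then 1 else e.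

Definition L2sq (n : nat) (f : R -> 'cV[R]_n) : \bar R :=
  (\int[leb]_x ((\sum_i (f x i 0) ^+ 2)%:E))%E.

End Defs.

(* Main.v *)
Require Import Defs.
From HB Require Import structures.
From mathcomp Require Import all_boot all_order all_algebra.
From mathcomp Require Import all_classical all_reals all_analysis.
From mathcomp Require Import measurable_realfun ring lra.
Import Order.TTheory GRing.Theory Num.Theory.
Import numFieldNormedType.Exports.
Set Implicit Arguments.
Unset Strict Implicit.
Unset Printing Implicit Defensive.
Local Open Scope classical_set_scope.
Local Open Scope ring_scope.

(** Existence by duality, in the manner of Friedrichs.  For a test function [phi],
    put [psi = phi_t + A phi_x + Q phi / eps(x)].  As [A] is symmetric and [Q] is
    symmetric and nonpositive, the energy identity run backwards in time gives
    [|| phi(., 0) || <= \int_0^oo || psi(., t) || dt], the norms being those of [L^2]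
    in [x].  Hence [psi |-> - \int phi(x, 0) . U0(x) dx] is well defined and bounded by
    [|| U0 ||] times the [L^1_t L^2_x] norm of [psi].  Extend it by Hahn-Banach and
    represent the extension by a density [U], using Radon-Nikodym: the representation
    is the weak form of the equation, and domination by the [L^1_t L^2_x] norm says
    that [U] has norm at most [|| U0 ||] in [L^oo_t L^2_x].  It remains to redefine [U]
    on a null set of times.

    To have finite measures and bounded functions throughout, the extension takes place
    over the standard normal distribution [P] in each variable: with [rho] its density,
    [psi(x, t)] is replaced by [psi(x, t) / (sqrt (rho x) * rho t)], whose [L^2(P)] norm
    in [x] is [|| psi(., t) || / rho t]. *)

(** * The Hahn-Banach theorem *)

(** The L^1 norm in time is dictated by the conclusion: its dual is L^oo in time, so the bound on
    the functional becomes a bound on U(., t) for almost every t, and no regularity of the solution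
    in time has to be proved. Symmetry of [A] makes the transport term of the energy a total
    x-derivative, while kappa = 1 / eps(x) is never differentiated and multiplies a quantity of
    known sign. The jump at x = 0 therefore calls for no interface condition: it is enough that
    kappa is measurable, bounded and nonnegative. The two weights differ because the two exponents
    do: dividing by sqrt (rho x) preserves an L^2 norm in x, dividing by rho t an L^1 norm in t, so
    the mixed norm over [P] is exactly the Lebesgue one. Undoing the normalization, psi . V / (sqrt
    (rho x) * rho t) against the density rho x * rho t is psi . (sqrt (rho x) V), whence U = sqrt
    (rho x) V. Over probability measures the mixed norm is also at most the L^2 norm, and this is
    what yields the countable additivity that Radon-Nikodym requires. *)

Section HahnBanach.
Context {R : realType} {V : lmodType R} (X : set V).
Hypothesis X0 : X 0.
Hypothesis XD : forall x y, X x -> X y -> X (x + y).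
Hypothesis XZ : forall c x, X x -> X (c *: x).

Definition sublinear_on (q : V -> R) :=
  (forall x y, X x -> X y -> q (x + y) <= q x + q y) /\
  (forall c x, X x -> 0 <= c -> q (c *: x) = c * q x).

Let XN x : X x -> X (- x). Proof. by move=> ?; rewrite -scaleN1r; exact: XZ. Qed.

Let sublinear0 q : sublinear_on q -> q 0 = 0.
Proof. by case=> _ /(_ 0 _ X0 (lexx 0)); rewrite scaler0 mul0r. Qed.

Let sublinearN q x : sublinear_on q -> X x -> - q (- x) <= q x.
Proof.
move=> sq Xx; have := sq.1 _ _ Xx (XN Xx).
by rewrite subrr (sublinear0 sq) -[0 <= _]subr_ge0 => h; lra.
Qed.

(** Each pair [a] in the cone [D] prescribes a lower bound: a linear functional below [q'] is at
    most q 0 - a.2 = - a.2 at - a.1, hence at least a.2 at a.1. The infimum defining [q'] is finite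
    because q (x + a.1) - a.2 >= q (x + a.1) - q a.1 >= - q (- x). *)
Lemma sublinear_inf_convolution (q : V -> R) (D : set (V * R)) :
  sublinear_on q -> D (0, 0) ->
  (forall a b, D a -> D b -> D (a.1 + b.1, a.2 + b.2)) ->
  (forall c a, 0 <= c -> D a -> D (c *: a.1, c * a.2)) ->
  (forall a, D a -> X a.1 /\ a.2 <= q a.1) ->
  exists q', [/\ sublinear_on q', forall x, X x -> q' x <= q x &
    forall x a, X x -> D a -> q' x <= q (x + a.1) - a.2].
Proof.
move=> sq D0 DD DZ Dq.
pose S x := [set q (x + a.1) - a.2 | a in D].
have Slb x : X x -> lbound (S x) (- q (- x)).
  move=> Xx _ [a Da <-]; have [Xa qa] := Dq _ Da.
  have := sq.1 _ _ (XD Xx Xa) (XN Xx); rewrite addrAC subrr add0r => h; lra.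
have Sn0 x : S x !=set0 by exists (q (x + 0) - 0), (0, 0).
have Shi x : X x -> has_inf (S x).
  by move=> Xx; split; [exact: Sn0|exists (- q (- x)); exact: Slb].
have Sle x a : X x -> D a -> inf (S x) <= q (x + a.1) - a.2.
  by move=> Xx Da; apply: ge_inf; [exact: (Shi _ Xx).2|exists a].
(* One inequality suffices: applied to [c^-1] at [c *: x] it gives the reverse one. *)
have infZ c x : X x -> 0 < c -> inf (S (c *: x)) <= c * inf (S x).
  move=> Xx c0; rewrite -ler_pdivrMl//; apply: (lb_le_inf (Sn0 _)) => _ [a Da <-].
  rewrite ler_pdivrMl//; apply: le_trans (Sle _ _ (XZ c Xx) (DZ _ _ (ltW c0) Da)) _ => /=.
  have [Xa _] := Dq _ Da.
  by rewrite -scalerDr (sq.2 c _ (XD Xx Xa) (ltW c0)) mulrBr.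
exists (fun x => inf (S x)); split.
- split.
    move=> x y Xx Xy /=; rewrite -lerBlDr; apply: (lb_le_inf (Sn0 _)) => _ [a Da <-].
    rewrite lerBlDr [leRHS]addrC -lerBlDr; apply: (lb_le_inf (Sn0 _)) => _ [b Db <-].
    have [Xa _] := Dq _ Da; have [Xb _] := Dq _ Db.
    have := Sle _ _ (XD Xx Xy) (DD _ _ Da Db) => /= h1.
    have := sq.1 _ _ (XD Xx Xa) (XD Xy Xb); rewrite addrACA => h2; lra.
  move=> c x Xx; rewrite le_eqVlt => /predU1P[<-|c0].
    rewrite scale0r mul0r; apply/eqP; rewrite eq_le; apply/andP; split.
      by apply: le_trans (Sle _ _ X0 D0) _; rewrite /= addr0 subr0 (sublinear0 sq).
    apply: (lb_le_inf (Sn0 _)) => _ [a Da <-].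
    by rewrite add0r subr_ge0; case: (Dq _ Da).
  apply/eqP; rewrite eq_le infZ//=.
  have := infZ c^-1 _ (XZ c Xx); rewrite scalerA mulVf ?gt_eqF// scale1r.
  by rewrite invr_gt0 ler_pdivlMl// => ->.
- by move=> x Xx; have := Sle _ _ Xx D0; rewrite /= addr0 subr0.
- by move=> x a Xx Da; exact: Sle.
Qed.

(** Zorn's lemma: the pointwise infimum of a chain below [p] is again sublinear, and it is finite
    since every member is at least - p (- x) at x. *)
Lemma minimal_sublinear (p : V -> R) : sublinear_on p ->
  exists q, [/\ sublinear_on q, forall x, X x -> q x <= p x &
    forall r, sublinear_on r -> (forall x, X x -> r x <= q x) ->
      forall x, X x -> r x = q x].
Proof.
move=> sp.
pose T := {q : V -> R | sublinear_on q /\ forall x, X x -> q x <= p x}.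
pose tp : T := exist _ p (conj sp (fun _ _ => lexx _)).
(* The order is reversed, so that a maximal element for [Rel] is a minimal functional. *)
pose Rel (s t : T) := `[< forall x, X x -> sval t x <= sval s x >].
have [||A tot|[q [sq qp]] qmin] := @ZL_preorder T tp Rel.
- by move=> t; apply/asboolP.
- by move=> r s t /asboolP h1 /asboolP h2; apply/asboolP => x Xx; apply: le_trans (h2 _ Xx) (h1 _ Xx).
- have [A0|/set0P[a0 Aa0]] := eqVneq A set0.
    by exists tp => s; rewrite A0.
  pose S x := [set sval a x | a in A].
  have Slb x : X x -> lbound (S x) (- p (- x)).
    move=> Xx _ [[a [sa pa]] _ <-] /=.
    by have := sublinearN sa Xx; have := pa _ (XN Xx); lra.
  have Sle x a : X x -> A a -> inf (S x) <= sval a x.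
    by move=> Xx Aa; apply: ge_inf; [exists (- p (- x)); exact: Slb|exists a].
  have Sn0 x : S x !=set0 by exists (sval a0 x), a0.
  have infZ c x : X x -> 0 < c -> inf (S (c *: x)) <= c * inf (S x).
    move=> Xx c0; rewrite -ler_pdivrMl//; apply: (lb_le_inf (Sn0 _)) => _ [a Aa <-].
    rewrite ler_pdivrMl//; apply: le_trans (Sle _ _ (XZ c Xx) Aa) _.
    by rewrite (svalP a).1.2 ?(ltW c0).
  have sS : sublinear_on (fun x => inf (S x)).
    split=> [x y Xx Xy|c x Xx] /=.
      rewrite -lerBlDr; apply: (lb_le_inf (Sn0 _)) => _ [a Aa <-].
      rewrite lerBlDr [leRHS]addrC -lerBlDr; apply: (lb_le_inf (Sn0 _)) => _ [b Ab <-].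
      rewrite lerBlDr [leRHS]addrC.
      (* Subadditivity of the infimum rests on totality of the chain: the smaller of the two members
         serves for both arguments. *)
      have [/asboolP ab|/asboolP ba] := tot _ _ Aa Ab.
        apply: le_trans (Sle _ _ (XD Xx Xy) Ab) _.
        by apply: le_trans ((svalP b).1.1 _ _ Xx Xy) _; rewrite lerD2r ab.
      apply: le_trans (Sle _ _ (XD Xx Xy) Aa) _.
      by apply: le_trans ((svalP a).1.1 _ _ Xx Xy) _; rewrite lerD2l ba.
    rewrite le_eqVlt => /predU1P[<-|c0].
      rewrite scale0r mul0r (_ : S 0 = [set 0]) ?inf1//.
      apply/seteqP; split=> [_ [a _ <-]|_ ->] /=; first exact: sublinear0 (svalP a).1.
      by exists a0 => //; exact: sublinear0 (svalP a0).1.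
    apply/eqP; rewrite eq_le infZ//=.
    have := infZ c^-1 _ (XZ c Xx); rewrite scalerA mulVf ?gt_eqF// scale1r.
    by rewrite invr_gt0 ler_pdivlMl// => ->.
  have Sp x : X x -> inf (S x) <= p x.
    by move=> Xx; apply: le_trans (Sle _ _ Xx Aa0) _; exact: (svalP a0).2.
  exists (exist _ (fun x => inf (S x)) (conj sS Sp) : T) => s As; apply/asboolP => x Xx /=; exact: Sle.
- exists q; split => // r sr rq x Xx.
  have rp y : X y -> r y <= p y by move=> Xy; apply: le_trans (rq _ Xy) (qp _ Xy).
  have /asboolP/= h := qmin (exist _ r (conj sr rp) : T) (introT (asboolP _) rq).
  by apply/eqP; rewrite eq_le rq// h.
Qed.

(* A minimal sublinear functional is linear; minimality is applied to the
   inf-convolution along the ray through [y]. *)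
Lemma Hahn_Banach_graph (p : V -> R) (D : set (V * R)) :
  sublinear_on p -> D (0, 0) ->
  (forall a b, D a -> D b -> D (a.1 + b.1, a.2 + b.2)) ->
  (forall c a, D a -> D (c *: a.1, c * a.2)) ->
  (forall a, D a -> X a.1 /\ a.2 <= p a.1) ->
  exists g : V -> R, [/\ forall x y, X x -> X y -> g (x + y) = g x + g y,
    forall c x, X x -> g (c *: x) = c * g x,
    forall x, X x -> g x <= p x & forall a, D a -> g a.1 = a.2].
Proof.
move=> sp D0 DD DZ Dp.
have [|//|p' [sp' p'p p'D]] := sublinear_inf_convolution sp D0 DD.
  by move=> c a _; exact: DZ.
have [q [sq qp' qmin]] := minimal_sublinear sp'.
have qadd y x : X y -> X x -> q (x + y) = q x + q y.
  move=> Xy Xx; pose E := [set (t *: y, t * q y) | t in [set t | 0 <= t]].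
  have [||||q' [sq' q'q q'E]] := @sublinear_inf_convolution q E sq.
  - by exists 0; rewrite /= ?scale0r ?mul0r.
  - move=> _ _ [t /= t0 <-] [u /= u0 <-]; exists (t + u); first exact: addr_ge0.
    by rewrite scalerDl mulrDl.
  - move=> c _ c0 [t /= t0 <-]; exists (c * t); first exact: mulr_ge0.
    by rewrite scalerA mulrA.
  - move=> _ [t /= t0 <-]; split; first exact: XZ.
    by rewrite sq.2.
  (* By minimality [q'] agrees with [q] on [X]; the point t = 1 of the ray then gives q x <= q (x +
     y) - q y, the reverse of subadditivity. *)
  apply/eqP; rewrite eq_le sq.1//= -(qmin _ sq' q'q x Xx).
  have := q'E x (y, q y) Xx; rewrite /= -lerBrDr; apply.
  by exists 1; rewrite /= ?ler01 ?scale1r ?mul1r.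
have qN x : X x -> q (- x) = - q x.
  move=> Xx; have := qadd _ _ Xx (XN Xx); rewrite addNr (sublinear0 sq) => h; lra.
have gD a : D a -> a.2 <= q a.1.
  move=> Da; have [Xa _] := Dp _ Da.
  have := p'D _ _ (XN Xa) Da; rewrite addNr (sublinear0 sp) sub0r => h.
  have := qp' _ (XN Xa); rewrite qN// => h2; lra.
exists q; split.
- by move=> x y Xx Xy; exact: qadd.
- move=> c x Xx; have [c0|c0] := leP 0 c; first exact: sq.2.
  by rewrite -[c]opprK scaleNr qN ?sq.2 ?oppr_ge0 ?ltW ?mulNr//; exact: XZ.
- by move=> x Xx; apply: le_trans (qp' _ Xx) (p'p _ Xx).
(* [D] is stable under multiplication by -1, so the lower bound at the opposite pair is the missing
   upper bound. *)
- move=> a Da; apply/eqP; rewrite eq_le gD// andbT.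
  have := gD _ (DZ (-1) _ Da); rewrite /= scaleN1r mulN1r qN ?lerN2//.
  by case: (Dp _ Da).
Qed.

End HahnBanach.

(** * Representing functionals on bounded measurable functions *)

Section BoundedMeasurable.
Context d {T : measurableType d} {R : realType}.
Implicit Types f g : T -> R.

(** The bound holds everywhere, not almost everywhere: the space does not depend on a measure, and
    it is preserved by taking slices at a fixed time. *)
Definition bounded_measurable f :=
  measurable_fun setT f /\ exists M, forall x, `|f x| <= M.

Lemma bounded_measurableD f g : bounded_measurable f -> bounded_measurable g ->
  bounded_measurable (fun x => f x + g x).
Proof.
move=> [mf [M fM]] [mg [N gN]]; split; first exact: measurable_funD.
by exists (M + N) => x; rewrite (le_trans (ler_normD _ _))// lerD.
Qed.

Lemma bounded_measurableM f g : bounded_measurable f -> bounded_measurable g ->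
  bounded_measurable (fun x => f x * g x).
Proof.
move=> [mf [M fM]] [mg [N gN]]; split; first exact: measurable_funM.
by exists (M * N) => x; rewrite normrM ler_pM.
Qed.

Lemma bounded_measurable_cst (c : R) : bounded_measurable (fun=> c).
Proof. by split; [exact: measurable_cst|exists `|c|]. Qed.

Lemma bounded_measurableZ (c : R) f : bounded_measurable f ->
  bounded_measurable (fun x => c * f x).
Proof. by move=> bf; apply: bounded_measurableM => //; exact: bounded_measurable_cst. Qed.

Lemma bounded_measurable_indic (A : set T) : measurable A ->
  bounded_measurable (\1_A : T -> R).
Proof.
move=> mA; split; first exact: measurable_indic.
by exists 1 => x; rewrite indicE; case: (_ \in _); rewrite ?normr1 ?normr0.
Qed.

Lemma bounded_measurable_sum (I : Type) (s : seq I) (F : I -> T -> R) :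
  (forall i, bounded_measurable (F i)) ->
  bounded_measurable (fun x => \sum_(i <- s) F i x).
Proof.
move=> bF; elim: s => [|i s IH].
  by under eq_fun do rewrite big_nil; exact: bounded_measurable_cst.
under eq_fun do rewrite big_cons; exact: bounded_measurableD.
Qed.

Lemma bounded_measurable_integrable (P : probability T R) f :
  bounded_measurable f -> P.-integrable setT (EFin \o f).
Proof.
move=> [mf [M fM]]; apply: measurable_bounded_integrable => //.
  by rewrite (le_lt_trans (probability_le1 _ _))// ltry.
exists M; split => //; first exact: num_real.
by move=> N MN x _; apply: le_trans (fM x) (ltW MN).
Qed.

Lemma bounded_measurable_integrableM (P : probability T R) f (V : T -> R) :
  bounded_measurable f -> P.-integrable setT (EFin \o V) ->
  P.-integrable setT (EFin \o (fun x => f x * V x)).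
Proof.
move=> [mf [M fM]] iV.
have mV : measurable_fun setT V by apply/measurable_EFinP; exact: measurable_int iV.
apply: (le_integrable measurableT _ _ (integrableZl measurableT M iV)).
  by apply/measurable_EFinP; exact: measurable_funM.
move=> x _ /=; rewrite lee_fin !normrM ler_wpM2r//.
by apply: le_trans (fM x) (ler_norm _).
Qed.

(* Peeling off the binary digits of [f] leaves a remainder of uniform norm [M / 2^k],
   without changing the value of [D]. *)
Lemma bounded_functional_eq0 (D : (T -> R) -> R) (c : R) :
  (forall f g, bounded_measurable f -> bounded_measurable g ->
     D (fun x => f x + g x) = D f + D g) ->
  (forall a f, bounded_measurable f -> D (fun x => a * f x) = a * D f) ->
  (forall A, measurable A -> D \1_A = 0) ->
  (forall f M, measurable_fun setT f -> 0 <= M -> (forall x, `|f x| <= M) ->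
     `|D f| <= c * M) ->
  forall f, bounded_measurable f -> D f = 0.
Proof.
move=> DD DZ D1 Db.
(* Adding a constant, on which [D] vanishes, reduces to nonnegative functions. *)
suff D0 f M : measurable_fun setT f -> 0 <= M -> (forall x, 0 <= f x <= M) -> D f = 0.
  move=> f bf; have [mf [M' fM']] := bf; pose M := `|M'|.
  have fM x : `|f x| <= M by rewrite (le_trans (fM' x))// ler_norm.
  have := D0 (fun x => f x + M * \1_setT x) (M + M); rewrite DD//; last first.
    by apply: bounded_measurableZ; exact: bounded_measurable_indic.
  rewrite DZ ?D1 ?mulr0 ?addr0//; last exact: bounded_measurable_indic.
  apply.
  - by apply: measurable_funD => //; exact: measurable_funM.
  - by rewrite addr_ge0 ?normr_ge0.
  - by move=> x; rewrite indicT mulr1; have := fM x; rewrite ler_norml; lra.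
move=> mf M0 fM.
have H (k : nat) : exists r : T -> R, [/\ measurable_fun setT r, forall x, 0 <= r x <= M / 2 ^+ k & D r = D f].
  elim: k => [|k [r [mr rM Dr]]]; first by exists f; rewrite expr0 divr1.
  pose b := M / 2 ^+ k.+1.
  have bE : M / 2 ^+ k = b + b.
    by rewrite /b exprS; field; rewrite expf_neq0.
  pose A := r @^-1` `[b, +oo[.
  have mA : measurable A by rewrite -[A]setTI; exact: mr.
  exists (fun x => r x + (- b) * \1_A x); split.
  - by apply: measurable_funD => //; apply: measurable_funM.
  - move=> x; have := rM x; rewrite bE -/b indicE.
    case: (boolP (x \in A)) => [/set_mem|/negP xA].
      by rewrite /A /= in_itv/= andbT mulr1 => ? ?; apply/andP; split; lra.
    rewrite mulr0 addr0 => /andP[-> _] /=; rewrite leNgt; apply/negP => bx.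
    by apply: xA; rewrite inE /A /= in_itv/= andbT ltW.
  - rewrite DD ?DZ ?D1 ?mulr0 ?addr0//.
    + exact: bounded_measurable_indic.
    + split => //; exists (M / 2 ^+ k) => x.
      by have /andP[r0 ?] := rM x; rewrite ger0_norm.
    + by apply: bounded_measurableZ; exact: bounded_measurable_indic.
have Dk k : `|D f| <= c * M * (2^-1) ^+ k.
  have [r [mr rM <-]] := H k; rewrite -mulrA exprVn; apply: Db => // [|x].
    by rewrite mulr_ge0// invr_ge0 exprn_ge0.
  by have /andP[r0 ?] := rM x; rewrite ger0_norm.
have cv : c * M * (2^-1) ^+ k @[k --> \oo] --> 0.
  rewrite -[X in _ --> X](mulr0 (c * M)); apply: cvgMl_tmp.
  by apply: cvg_expr; rewrite ger0_norm ?invr_ge0 ?ler0n// invf_lt1// ltr1n.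
apply/eqP; rewrite -normr_le0 -(cvg_lim (@Rhausdorff R) cv).
by apply: limr_ge; [apply/cvg_ex; exists 0|exact: nearW].
Qed.

End BoundedMeasurable.

(** * Densities of functionals that are bounded in L^2 of a probability measure *)

Section RadonNikodymRepresentation.
Context d {T : measurableType d} {R : realType} (P : probability T R).
Variables (G : (T -> R) -> R) (C : R).
Hypothesis GD : forall f g, bounded_measurable f -> bounded_measurable g ->
  G (fun x => f x + g x) = G f + G g.
Hypothesis GZ : forall a f, bounded_measurable f -> G (fun x => a * f x) = a * G f.
Hypothesis Gb : forall f, bounded_measurable f ->
  G f ^+ 2 <= C * Rintegral P setT (fun x => f x ^+ 2).

Definition functional_charge (A : set T) : \bar R := (G \1_A)%:E.

(** An indicator is its own square, so the L^2 bound controls the functional on [A] by the measure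
    of [A]. Absolute continuity and countable additivity both come from this. *)
Let G_indic_bound A : measurable A -> G \1_A ^+ 2 <= C * fine (P A).
Proof.
move=> mA; apply: le_trans (Gb (bounded_measurable_indic mA)) _.
rewrite le_eqVlt; apply/orP; left; apply/eqP; congr (_ * _).
rewrite -[in RHS](setIT A) -(integral_indic P _ mA)// /Rintegral; congr fine.
apply: eq_integral => x _; rewrite indicE; case: (_ \in _); by rewrite ?expr1n ?expr0n.
Qed.

Let functional_charge0 : functional_charge set0 = 0%E.
Proof.
rewrite /functional_charge indic0 (_ : cst 0 = fun x => 0 * cst 0 x) ?GZ ?mul0r//.
  exact: bounded_measurable_cst.
by apply/funext => x; rewrite mul0r.
Qed.

Let functional_charge_fin A : measurable A -> functional_charge A \is a fin_num.
Proof. by []. Qed.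

Let G_indic_setU A B : measurable A -> measurable B -> A `&` B = set0 ->
  G \1_(A `|` B) = G \1_A + G \1_B.
Proof.
move=> mA mB AB; rewrite -GD; [|exact: bounded_measurable_indic..].
congr G; apply/funext => x; rewrite !indicE in_setU.
case: (boolP (x \in A)) => xA; case: (boolP (x \in B)) => xB; rewrite ?addr0 ?add0r//.
have : (A `&` B) x by split; exact/set_mem.
by rewrite AB.
Qed.

(** The remainders [U \ S n] decrease to the empty set, so their probability tends to 0, and
    [G_indic_bound] carries this over to [G]. *)
Let functional_charge_sigma_additive : semi_sigma_additive functional_charge.
Proof.
move=> F mF tF mUF.
pose S n := \big[setU/set0]_(i < n) F i.
have mS n : measurable (S n) by exact: bigsetU_measurable.
have sumE n : (\sum_(0 <= i < n) functional_charge (F i) = functional_charge (S n))%E.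
  elim: n => [|n IH]; first by rewrite big_nil /S big_ord0 functional_charge0.
  rewrite big_nat_recr//= IH /functional_charge -EFinD -G_indic_setU//.
    by rewrite /S big_ord_recr.
  rewrite -subset0 /S -bigcup_mkord => x [[i /= ni Fi] Fn].
  by have := tF i n I I (ex_intro _ x (conj Fi Fn)) => iE; rewrite iE ltnn in ni.
under eq_fun do rewrite sumE.
pose U := \bigcup_n F n.
have SU n : S n `<=` U by exact: bigsetU_bigcup.
have mUS n : measurable (U `\` S n) by exact: measurableD.
have dE n : G \1_(S n) = G \1_U - G \1_(U `\` S n).
  apply/eqP; rewrite eq_sym subr_eq -G_indic_setU// ?setDUK//.
  by rewrite -subset0 => x [? []].
have PD : P (U `\` S n) @[n --> \oo] --> 0%E.
  have capE : \bigcap_n (U `\` S n) = set0.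
    rewrite -subset0 => x H; have [[k _ Fk] _] := H 0 I.
    have [_] := H k.+1 I; apply; rewrite /S -bigcup_mkord; exists k => //=.
  rewrite -(measure0 P) -capE; apply: nonincreasing_cvg_mu => //.
  - by rewrite (le_lt_trans (probability_le1 _ _))// ltry.
  - by rewrite capE.
  - move=> m n mn; apply/subsetPset; apply: setDS.
    exact: subset_bigsetU.
suff cv : G \1_(S n) @[n --> \oo] --> G \1_U by apply: cvg_EFin; [exact: nearW|].
suff cv0 : G \1_(U `\` S n) @[n --> \oo] --> 0.
  have := cvgB (cvg_cst (G \1_U)) cv0; rewrite subr0 => cvU.
  have SE : (fun n => G \1_(S n)) = cst (G \1_U) \- (fun n => G \1_(U `\` S n)) by apply/funext.
  by rewrite SE; exact: cvU.
apply/cvgr0Pnorm_lt => e e0.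
have : C * fine (P (U `\` S n)) @[n --> \oo] --> C * fine 0%E.
  by apply: cvgMl_tmp; apply: fine_cvg.
rewrite mulr0 => /cvgr0Pnorm_lt/(_ (e ^+ 2)); rewrite exprn_gt0// => /(_ isT).
apply: filterS => n /(le_lt_trans (ler_norm _)) /(le_lt_trans (G_indic_bound (mUS n))).
by rewrite -real_normK ?num_real// ltr_pXn2r// nnegrE ltW.
Qed.

HB.instance Definition _ := isCharge.Build _ _ _ functional_charge
  functional_charge0 functional_charge_fin functional_charge_sigma_additive.

(** The Radon-Nikodym derivative of the charge represents [G] on indicators. The difference of the
    two sides is continuous for the uniform norm, so [bounded_functional_eq0] extends the identity
    to bounded functions. *)
Lemma Radon_Nikodym_representation : exists V : T -> R,
  P.-integrable setT (EFin \o V) /\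
  forall f, bounded_measurable f -> G f = Rintegral P setT (fun x => f x * V x).
Proof.
pose nu : {charge set T -> \bar R} := functional_charge.
have nuP : nu `<< P.
  apply/null_content_dominatesP => A mA PA.
  have := G_indic_bound mA; rewrite PA mulr0 => h.
  congr EFin; apply/eqP; have : G \1_A ^+ 2 == 0 by rewrite eq_le h sqr_ge0.
  by rewrite expf_eq0.
pose V x := fine (Radon_Nikodym nu P x).
have VE : EFin \o V = Radon_Nikodym nu P.
  by apply/funext => x /=; rewrite fineK//; exact: Radon_Nikodym_fin_num.
have iV : P.-integrable setT (EFin \o V).
  by rewrite VE; exact: Radon_Nikodym_integrable.
exists V; split => // f bf.
pose D f := G f - Rintegral P setT (fun x => f x * V x).
have iM h : bounded_measurable h -> P.-integrable setT (EFin \o (fun x => h x * V x)).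
  by move=> bh; exact: bounded_measurable_integrableM.
apply/eqP; rewrite -subr_eq0; apply/eqP.
have P1 : fine (P setT) = 1 by rewrite probability_setT.
have C0 : 0 <= C.
  have := Gb (bounded_measurable_cst 1).
  rewrite Rintegral_cst// P1 expr1n !mulr1.
  exact: le_trans (sqr_ge0 _).
(* The first term bounds [G] on functions of uniform norm 1, as [P] has mass 1; the second bounds
   the integral against [V]. *)
pose c := Num.sqrt C + Rintegral P setT (fun x => `|V x|).
apply: (@bounded_functional_eq0 _ _ _ D c) => //.
- move=> g h bg bh; rewrite /D GD//.
  under [in LHS]eq_Rintegral do rewrite mulrDl.
  by rewrite RintegralD//; [lra|exact: iM..].
- move=> a h bh; rewrite /D GZ//.
  under [in LHS]eq_Rintegral do rewrite -mulrA.
  by rewrite RintegralZl ?mulrBr//; exact: iM.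
- move=> A mA; rewrite /D /Rintegral.
  have -> : (\int[P]_x (\1_A x * V x)%:E = functional_charge A)%E.
    rewrite /functional_charge -[RHS]/(nu A) (Radon_Nikodym_integral nuP mA).
    rewrite [RHS]integral_mkcond; apply: eq_integral => x _.
    rewrite patchE -VE /= indicE; case: (_ \in _); by rewrite ?mul1r ?mul0r.
  by rewrite subrr.
- move=> g M mg M0 gM.
  have bg : bounded_measurable g by split => //; exists M.
  rewrite /D (le_trans (ler_normB _ _))// mulrDl lerD//.
    rewrite -(ler_pXn2r (ltn0Sn 1)) ?nnegrE ?mulr_ge0 ?sqrtr_ge0// real_normK ?num_real//.
    rewrite exprMn sqr_sqrtr//.
    apply: le_trans (Gb bg) _; rewrite ler_wpM2l//.
    rewrite -[leRHS]mulr1 -P1 -Rintegral_cst//; apply: le_Rintegral => //.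
    + by apply: bounded_measurable_integrable; exact: bounded_measurableM.
    + exact: finite_measure_integrable_cst.
    + by move=> x _; rewrite -[g x ^+ 2]real_normK ?num_real// lerXn2r ?nnegrE.
  apply: le_trans (le_normr_Rintegral _ _) _ => //; first exact: iM.
  rewrite -RintegralZr//; last exact: integrable_norm.
  apply: le_Rintegral => //.
  + by have := integrable_norm (iM _ bg).
  + by have := integrableZr measurableT M (integrable_norm iV).
  + by move=> x _; rewrite normrM mulrC ler_wpM2l.
Qed.
End RadonNikodymRepresentation.

(** * Square-integrable families *)

(** The quadratic is evaluated at its vertex - b / a. If a = 0 and b is nonzero, the point chosen
    makes the affine function equal to -1, a contradiction. *)
Lemma discriminant_le0 {R : realFieldType} (a b c : R) :
  0 <= a -> (forall s, 0 <= a * s ^+ 2 + 2 * b * s + c) -> b ^+ 2 <= a * c.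
Proof.
rewrite le_eqVlt => /predU1P[<-|a0] H.
  have [->|b0] := eqVneq b 0; first by rewrite expr0n mul0r.
  have := H (- (c + 1) / (2 * b)).
  have -> : 0 * (- (c + 1) / (2 * b)) ^+ 2 + 2 * b * (- (c + 1) / (2 * b)) + c = -1 by field.
  by rewrite oppr_ge0 ler10.
have := H (- b / a).
have -> : a * (- b / a) ^+ 2 + 2 * b * (- b / a) + c = (a * c - b ^+ 2) / a.
  by field; rewrite gt_eqF.
by rewrite pmulr_lge0 ?invr_gt0// subr_ge0.
Qed.

Section SquareIntegrableFamilies.
Context d {T : measurableType d} {R : realType} (mu : {measure set T -> \bar R}).

Definition square_integrable (f : T -> R) :=
  measurable_fun setT f /\ mu.-integrable setT (EFin \o (fun x => f x ^+ 2)).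

Lemma square_integrable_integrableM f g : square_integrable f -> square_integrable g ->
  mu.-integrable setT (EFin \o (fun x => f x * g x)).
Proof.
move=> [mf f2] [mg g2].
have fg2 : mu.-integrable setT (EFin \o (fun x => f x ^+ 2 + g x ^+ 2)).
  by have := integrableD measurableT f2 g2; apply: eq_integrable.
apply: (le_integrable measurableT _ _ fg2).
  by apply/measurable_EFinP; exact: measurable_funM.
move=> x _ /=; rewrite lee_fin [leRHS]ger0_norm ?addr_ge0 ?sqr_ge0//.
have := sqr_ge0 (f x - g x); have := sqr_ge0 (f x + g x).
have := sqr_ge0 (f x); have := sqr_ge0 (g x).
by rewrite ler_norml => *; apply/andP; split; nra.
Qed.

Lemma square_integrableD f g : square_integrable f -> square_integrable g ->
  square_integrable (fun x => f x + g x).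
Proof.
move=> sf sg; have [mf f2] := sf; have [mg g2] := sg.
split; first exact: measurable_funD.
have := integrableD measurableT (integrableD measurableT f2 g2)
  (integrableZl measurableT 2 (square_integrable_integrableM sf sg)).
apply: eq_integrable => // x _ /=; rewrite -EFinM -!EFinD; congr EFin; ring.
Qed.

Lemma square_integrableZ c f : square_integrable f -> square_integrable (fun x => c * f x).
Proof.
move=> [mf f2]; split; first exact: measurable_funM.
have := integrableZl measurableT (c ^+ 2) f2.
by apply: eq_integrable => // x _ /=; rewrite -EFinM exprMn.
Qed.

Lemma square_integrable_sum (I : Type) (s : seq I) (F : I -> T -> R) :
  (forall i, square_integrable (F i)) ->
  square_integrable (fun x => \sum_(i <- s) F i x).
Proof.
move=> bF; elim: s => [|i s IH].
  under eq_fun do rewrite big_nil.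
  split; first exact: measurable_cst.
  have := integrable0 mu [set: T]; apply: eq_integrable => // x _ /=.
  by rewrite expr0n.
under eq_fun do rewrite big_cons; exact: square_integrableD.
Qed.

Context {n : nat}.
Implicit Types f g : 'I_n -> T -> R.

Definition inner f g := Rintegral mu setT (fun x => \sum_i f i x * g i x).
Definition square_integrables f := forall i, square_integrable (f i).

Lemma square_integrables_integrable f g :
  square_integrables f -> square_integrables g ->
  mu.-integrable setT (EFin \o (fun x => \sum_i f i x * g i x)).
Proof.
move=> sf sg; have := integrable_sum measurableT (index_enum 'I_n)
  (fun i (_ : xpredT i) => square_integrable_integrableM (sf i) (sg i)).
by apply: eq_integrable => // x _ /=; rewrite sumEFin.
Qed.

Lemma inner_ge0 f : 0 <= inner f f.
Proof. by apply: Rintegral_ge0 => x _; apply: sumr_ge0 => i _; rewrite -expr2 sqr_ge0. Qed.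

Lemma innerC f g : inner f g = inner g f.
Proof. by apply: eq_Rintegral => x _; apply: eq_bigr => i _; rewrite mulrC. Qed.

Lemma innerDl f g h : square_integrables f -> square_integrables g ->
  square_integrables h ->
  inner (fun i x => f i x + g i x) h = inner f h + inner g h.
Proof.
move=> sf sg sh; rewrite /inner -RintegralD//; [|exact: square_integrables_integrable..].
by apply: eq_Rintegral => x _; rewrite -big_split; apply: eq_bigr => i _; rewrite mulrDl.
Qed.

Lemma innerZl c f h : square_integrables f -> square_integrables h ->
  inner (fun i x => c * f i x) h = c * inner f h.
Proof.
move=> sf sh; rewrite /inner -RintegralZl//; last exact: square_integrables_integrable.
by apply: eq_Rintegral => x _; rewrite mulr_sumr; apply: eq_bigr => i _; rewrite mulrA.
Qed.

Lemma inner_sqrD f g : square_integrables f -> square_integrables g ->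
  inner (fun i x => f i x + g i x) (fun i x => f i x + g i x) =
  inner f f + 2 * inner f g + inner g g.
Proof.
move=> sf sg; have sfg : square_integrables (fun i x => f i x + g i x).
  by move=> i; exact: square_integrableD.
rewrite innerDl// (innerC f) (innerC g) !innerDl// (innerC g f); ring.
Qed.

Lemma inner_CauchySchwarz f g : square_integrables f -> square_integrables g ->
  inner f g ^+ 2 <= inner f f * inner g g.
Proof.
move=> sf sg; apply: discriminant_le0 => [|s]; first exact: inner_ge0.
have sZ : square_integrables (fun i x => s * f i x).
  by move=> i; exact: square_integrableZ.
have := inner_ge0 (fun i x => s * f i x + g i x).
rewrite inner_sqrD// innerZl// (innerC f) innerZl// innerZl//.
by congr (0 <= _); ring.
Qed.

Lemma inner_le_sqrt f g : square_integrables f -> square_integrables g ->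
  `|inner f g| <= Num.sqrt (inner f f) * Num.sqrt (inner g g).
Proof.
move=> sf sg; rewrite -sqrtrM ?inner_ge0// -sqrtr_sqr ler_sqrt ?mulr_ge0 ?inner_ge0//.
exact: inner_CauchySchwarz.
Qed.

Lemma inner_Minkowski f g : square_integrables f -> square_integrables g ->
  Num.sqrt (inner (fun i x => f i x + g i x) (fun i x => f i x + g i x)) <=
  Num.sqrt (inner f f) + Num.sqrt (inner g g).
Proof.
move=> sf sg; rewrite -[leRHS]ger0_norm ?addr_ge0 ?sqrtr_ge0// -sqrtr_sqr.
rewrite ler_sqrt ?sqr_ge0// inner_sqrD// sqrrD !sqr_sqrtr ?inner_ge0//.
rewrite lerD2r lerD2l mulr_natl lerMn2r /=.
by apply: le_trans (inner_le_sqrt sf sg); exact: ler_norm.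
Qed.

End SquareIntegrableFamilies.

(** * The Gaussian density *)

Section GaussianDensity.
Context {R : realType}.
Local Notation leb := (@lebesgue_measure R).
Local Notation P := (@normal_prob R 0 1).

Definition rho : R -> R := normal_pdf 0 1.
Definition rho2 (p : R * R) : R := rho p.1 * rho p.2.

Lemma rho_gt0 x : 0 < rho x.
Proof.
rewrite /rho normal_pdfE ?oner_neq0//.
by rewrite mulr_gt0 ?normal_peak_gt0 ?oner_neq0// expR_gt0.
Qed.

Lemma rho_ge0 x : 0 <= rho x. Proof. exact/ltW/rho_gt0. Qed.

Lemma rho_neq0 x : rho x != 0. Proof. by rewrite gt_eqF ?rho_gt0. Qed.

Lemma continuous_rho : continuous rho.
Proof. by apply: continuous_normal_pdf; exact: oner_neq0. Qed.

Lemma measurable_rho : measurable_fun setT rho.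
Proof. exact: measurable_normal_pdf. Qed.

Lemma rho2_gt0 p : 0 < rho2 p. Proof. by rewrite mulr_gt0 ?rho_gt0. Qed.

Lemma measurable_rho2 : measurable_fun setT rho2.
Proof.
apply: measurable_funM.
  exact: (measurableT_comp measurable_rho measurable_fst).
exact: (measurableT_comp measurable_rho measurable_snd).
Qed.

Local Open Scope ereal_scope.

(** The change of variables is available for the Radon-Nikodym derivative of [P]; this derivative
    equals [rho] almost everywhere because both have the same integral on every measurable set. *)
Lemma integral_normal_prob_density (f : R -> \bar R) : (forall x, 0 <= f x) ->
  measurable_fun setT f ->
  \int[P]_x f x = \int[leb]_x (f x * (rho x)%:E).
Proof.
move=> f0 mf; have Pleb := normal_prob_dominates (0 : R) (1 : R).
have := @Radon_Nikodym_SigmaFinite.change_of_variables _ _ _ P leb Pleb f setT f0 measurableT mf.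
move=> <-; apply: ae_eq_integral => //.
- apply: emeasurable_funM => //.
  exact: measurable_int (Radon_Nikodym_SigmaFinite.f_integrable Pleb).
- apply: emeasurable_funM => //; apply/measurable_EFinP; exact: measurable_rho.
apply: ae_eqe_mul2l; apply: ae_eq_sym; apply: integral_ae_eq => //.
- exact: integrable_normal_pdf.
- exact: measurable_int (Radon_Nikodym_SigmaFinite.f_integrable Pleb).
- by move=> E _ mE; rewrite -Radon_Nikodym_SigmaFinite.f_integral.
Qed.

Lemma integral_normal_prob_density2 (f : R * R -> \bar R) : (forall p, 0 <= f p) ->
  measurable_fun setT f ->
  \int[P \x P]_p f p = \int[leb \x leb]_p (f p * (rho2 p)%:E).
Proof.
move=> f0 mf; rewrite fubini_tonelli1// fubini_tonelli1//=; last 2 first.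
- apply: emeasurable_funM => //; apply/measurable_EFinP; exact: measurable_rho2.
- by move=> p; rewrite mule_ge0// lee_fin ltW// rho2_gt0.
rewrite /fubini_F integral_normal_prob_density//; last 2 first.
- by move=> x; apply: integral_ge0.
- exact: (@measurable_fun_fubini_tonelli_F _ _ _ _ R P f mf f0).
apply: eq_integral => x _; rewrite integral_normal_prob_density//; last first.
  exact: measurable_fun_pair2.
rewrite -ge0_integralZr//; last 3 first.
- apply: emeasurable_funM; first exact: measurable_fun_pair2.
  by apply/measurable_EFinP; exact: measurable_rho.
- by move=> y _; rewrite mule_ge0// lee_fin rho_ge0.
- by rewrite lee_fin rho_ge0.
apply: eq_integral => y _; rewrite -muleA -EFinM /rho2 /=; congr (_ * _%:E).
by rewrite mulrC.
Qed.

(** Positive and negative parts are treated separately by the nonnegative case; multiplication by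
    the positive [rho2] commutes with taking either part. *)
Lemma Rintegral_normal_prob_density2 (f : R * R -> R) :
  (P \x P).-integrable setT (EFin \o f) ->
  (leb \x leb).-integrable setT (EFin \o (fun p => f p * rho2 p)%R) /\
  Rintegral (P \x P) setT f = Rintegral (leb \x leb) setT (fun p => f p * rho2 p)%R.
Proof.
move=> fi; have /integrableP[/measurable_EFinP mf foo] := fi.
have mfr : measurable_fun setT (fun p => f p * rho2 p)%R.
  by apply: measurable_funM => //; exact: measurable_rho2.
have dE (g : R * R -> R) : measurable_fun setT g -> (forall p, 0 <= g p)%R ->
    \int[P \x P]_p (g p)%:E = \int[leb \x leb]_p (g p * rho2 p)%:E.
  move=> mg g0; rewrite integral_normal_prob_density2//.
  exact/measurable_EFinP.
split.
  apply/integrableP; split; first exact/measurable_EFinP.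
  have := foo; rewrite -[X in X < _]/(\int[P \x P]_p `|f p|%:E) dE//; last first.
    exact: measurableT_comp.
  congr (_ < _); apply: eq_integral => p _.
  by rewrite /= normrM (ger0_norm (ltW (rho2_gt0 p))).
rewrite /Rintegral integralE [in RHS]integralE; congr (fine (_ - _)).
  transitivity (\int[P \x P]_p (Num.max (f p) 0)%:E).
    by apply: eq_integral => p _; rewrite funeposE -EFin_max.
  rewrite dE; last 2 first.
  - exact: measurable_maxr.
  - by move=> p; rewrite le_max lexx orbT.
  apply: eq_integral => p _; rewrite funeposE -EFin_max; congr EFin.
  by rewrite maxr_pMl ?mul0r// ltW// rho2_gt0.
transitivity (\int[P \x P]_p (Num.max (- f p) 0)%:E).
  by apply: eq_integral => p _; rewrite funenegE -EFinN -EFin_max.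
rewrite dE; last 2 first.
- by apply: measurable_maxr => //; exact: measurable_funN.
- by move=> p; rewrite le_max lexx orbT.
apply: eq_integral => p _; rewrite funenegE -EFinN -EFin_max; congr EFin.
by rewrite maxr_pMl ?mul0r ?mulNr// ltW// rho2_gt0.
Qed.

End GaussianDensity.

(** * Test functions *)

(** The sigma-algebra on the plane is generated by rectangles, so an open set has to be exhibited as
    a countable union of them: the boxes with rational centre and radius 1 / (k + 1) that it
    contains. *)
Lemma continuous2_measurable {R : realType} (f : R * R -> R) :
  continuous f -> measurable_fun setT f.
Proof.
move=> cf; apply: (measurability _ (RGenOpens.measurableE R)).
move=> _ [_ [a [b ->] <-]]; rewrite setTI.
set U := f @^-1` _.
have oU : open U by move/continuousP : cf; apply; exact: interval_open.
pose box (i : rat * rat * nat) : set (R * R) :=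
  ball (ratr i.1.1 : R) i.2.+1%:R^-1 `*` ball (ratr i.1.2 : R) i.2.+1%:R^-1.
have -> : U = \bigcup_i (if `[< box i `<=` U >] then box i else set0).
  apply/seteqP; split=> [[x t] Uxt|p [i _]]; last by case: ifPn => // /asboolP iU /iU.
  have [e /= e0 eU] : nbhs_ball (x, t) U by apply/nbhs_ballP; exact: open_nbhs_nbhs.
  (* Half of [e]: any point of the box is within one radius of the centre, which is itself within
     one radius of (x, t). *)
  have [k _ ke] := near_infty_natSinv_lt (PosNum (divr_gt0 e0 (ltr0n R 2))).
  have {ke}/= ke := ke k (leqnn k).
  have d0 : 0 < k.+1%:R^-1 :> R by rewrite invr_gt0.
  have approx (y : R) : exists q : rat, ball (ratr q : R) k.+1%:R^-1 y.
    move: (k.+1%:R^-1) d0 => d d0.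
    have /rat_in_itvoo[q] : y - d < y + d by lra.
    rewrite in_itv/= => /andP[h1 h2]; exists q.
    by rewrite /ball/= ltr_distl; apply/andP; split.
  have [q1 q1x] := approx x; have [q2 q2t] := approx t.
  exists (q1, q2, k) => //; rewrite asboolT//.
  move=> [y s] [/= b1 b2]; apply: eU.
  have e2 : k.+1%:R^-1 + k.+1%:R^-1 <= e.
    by rewrite (splitr e) lerD// ltW.
  split => /=; apply: (le_ball e2).
    exact: (ball_triangle (ball_sym q1x) b1).
  exact: (ball_triangle (ball_sym q2t) b2).
apply: countable_bigcupT_measurable => [|i]; first exact: countableP.
case: ifPn => // _; apply: measurableX; exact: measurable_ball.
Qed.

Lemma continuous2_bounded_on_box {R : realType} (f : R * R -> R) (M : R) :
  continuous f -> exists C, forall x t, `|x| <= M -> `|t| <= M -> `|f (x, t)| <= C.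
Proof.
move=> cf; have cK : compact (`[- M, M] `*` `[- M, M] : set (R * R)).
  by apply: compact_setX; exact: segment_compact.
have : bounded_set (f @` (`[- M, M] `*` `[- M, M])).
  apply: compact_bounded; apply: continuous_compact => //.
  exact: continuous_subspaceT.
move=> [C [_ CP]]; exists (C + 1) => x t xM tM.
apply: (CP (C + 1)); first by rewrite ltrDl.
by exists (x, t) => //=; split; rewrite /= in_itv/= -ler_norml.
Qed.

Lemma continuous2_bounded {R : realType} (f : R * R -> R) (M : R) :
  continuous f -> (forall x t, M < `|x| \/ M < `|t| -> f (x, t) = 0) ->
  exists C, forall p, `|f p| <= C.
Proof.
move=> cf f0; have [C fC] := continuous2_bounded_on_box M cf.
exists (Num.max C 0) => -[x t].
have [xM|xM] := ltP M `|x|; first by rewrite f0 ?normr0 ?le_max ?lexx ?orbT//; left.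
have [tM|tM] := ltP M `|t|; first by rewrite f0 ?normr0 ?le_max ?lexx ?orbT//; right.
by rewrite le_max fC.
Qed.

Section TestFunctions.
Context {R : realType}.
Implicit Types f g : R -> R -> R.

Lemma smooth2_partial_x f : smooth2 f -> smooth2 (partial_x f).
Proof. by move=> sf s; have := sf (rcons s false); rewrite /iter_partial foldr_rcons. Qed.

Lemma smooth2_partial_t f : smooth2 f -> smooth2 (partial_t f).
Proof. by move=> sf s; have := sf (rcons s true); rewrite /iter_partial foldr_rcons. Qed.

Lemma smooth2_continuous f : smooth2 f -> continuous (fun p : R * R => f p.1 p.2).
Proof. by move=> /(_ [::])[]. Qed.

Lemma smooth2_derivable_x f t x : smooth2 f -> derivable (f^~ t) x 1.
Proof. by move=> /(_ [::])[_ []] /(_ x t). Qed.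

Lemma smooth2_derivable_t f x t : smooth2 f -> derivable (f x) t 1.
Proof. by move=> /(_ [::])[_ []] _ /(_ x t). Qed.

Lemma iter_partialD s f g : smooth2 f -> smooth2 g ->
  iter_partial s (fun x t => f x t + g x t) =
  (fun x t => iter_partial s f x t + iter_partial s g x t).
Proof.
move=> sf sg; elim: s => //= b s ->; have [_ [fx ft]] := sf s; have [_ [gx gt]] := sg s.
apply/funext => x; apply/funext => t.
case: b; rewrite /partial_t /partial_x !derive1E -deriveD//.
Qed.

Lemma iter_partialZ s c f : smooth2 f ->
  iter_partial s (fun x t => c * f x t) = (fun x t => c * iter_partial s f x t).
Proof.
move=> sf; elim: s => //= b s ->; have [_ [fx ft]] := sf s.
apply/funext => x; apply/funext => t.
case: b; rewrite /partial_t /partial_x.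
  by rewrite (derive1Ml c (ft x t)).
by rewrite (derive1Ml c (fx x t)).
Qed.

Lemma smooth2D f g : smooth2 f -> smooth2 g -> smooth2 (fun x t => f x t + g x t).
Proof.
move=> sf sg s; rewrite iter_partialD//; have [fc [fx ft]] := sf s; have [gc [gx gt]] := sg s.
split; first by move=> p; apply: cvgD; [exact: fc|exact: gc].
by split=> x t; exact: derivableD.
Qed.

Lemma smooth2Z c f : smooth2 f -> smooth2 (fun x t => c * f x t).
Proof.
move=> sf s; rewrite iter_partialZ//; have [fc [fx ft]] := sf s.
split; first by move=> p; apply: cvgMl_tmp; exact: fc.
by split=> x t; exact: derivableZ.
Qed.

Definition supported_in (M : R) f := forall x t, M < `|x| \/ M < `|t| -> f x t = 0.

Let near_norm_gt (M x : R) : M < `|x| -> \forall y \near x, M < `|y|.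
Proof. by move=> Mx; have := @norm_continuous _ _ x; move/cvgr_gt; apply. Qed.

(** The exterior of the support is open: for |x| > M the function vanishes on a neighbourhood of x,
    and for |t| > M on the whole horizontal line. *)
Lemma supported_in_partial_x M f : supported_in M f -> supported_in M (partial_x f).
Proof.
move=> f0 x t xt; rewrite /partial_x derive1E -(derive_cst (0 : R) x 1).
case: xt => [xM|tM]; last by congr ('D_1 _ x); apply/funext => y; rewrite f0//; right.
apply: near_eq_derive; near do rewrite f0//.
by near=> y; left; near: y; exact: near_norm_gt.
Unshelve. all: by end_near. Qed.

Lemma supported_in_partial_t M f : supported_in M f -> supported_in M (partial_t f).
Proof.
move=> f0 x t xt; rewrite /partial_t derive1E -(derive_cst (0 : R) t 1).
case: xt => [xM|tM]; first by congr ('D_1 _ t); apply/funext => y; rewrite f0//; left.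
apply: near_eq_derive; near=> y; rewrite f0//; right; near: y; exact: near_norm_gt.
Unshelve. all: by end_near. Qed.

Lemma smooth2_bounded M f : smooth2 f -> supported_in M f ->
  exists C, forall x t, `|f x t| <= C.
Proof.
move=> sf f0; have [|C fC] := continuous2_bounded (M := M) (smooth2_continuous sf).
  by move=> x t; exact: f0.
by exists C => x t; exact: (fC (x, t)).
Qed.

Lemma smooth2_measurable f : smooth2 f -> measurable_fun setT (fun p : R * R => f p.1 p.2).
Proof. by move=> sf; apply: continuous2_measurable; exact: smooth2_continuous. Qed.

End TestFunctions.

(** * The energy estimate *)

Section CompactSupport.
Context {R : realType}.
Local Notation leb := (@lebesgue_measure R).
Implicit Types f : R -> R.

Lemma bounded_support_integrable f (M C : R) : measurable_fun setT f ->
  (forall x, `|f x| <= C) -> (forall x, M < `|x| -> f x = 0) ->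
  leb.-integrable setT (EFin \o f).
Proof.
move=> mf fC f0.
have := integrableZl measurableT C (integrable_indic_itv (- M) M true false).
apply: (le_integrable measurableT); first exact/measurable_EFinP.
move=> x _ /=; rewrite lee_fin indicE.
have [xM|xM] := ltP M `|x|; first by rewrite f0// normr0.
rewrite mem_set ?mulr1; first exact: le_trans (fC x) (ler_norm _).
by rewrite /= in_itv/= -ler_norml.
Qed.

Lemma bounded_support_square_integrable f (M C : R) : measurable_fun setT f ->
  (forall x, `|f x| <= C) -> (forall x, M < `|x| -> f x = 0) ->
  square_integrable leb f.
Proof.
move=> mf fC f0; split => //.
apply: (@bounded_support_integrable _ M (C * C)); first exact: measurable_funX.
  by move=> x; rewrite expr2 normrM ler_pM.
by move=> x /f0 ->; rewrite expr0n.
Qed.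

Lemma Rintegral_derive1_eq0 (H h : R -> R) (M : R) :
  (forall x : R, is_derive x 1 H (h x)) -> continuous h ->
  (forall x, M < `|x| -> H x = 0) -> (forall x, M < `|x| -> h x = 0) ->
  Rintegral leb setT h = 0.
Proof.
(* Beyond the support, and positive whatever the sign of [M], so that [-b, b] is nondegenerate and
   [H] vanishes at both ends. *)
move=> dH ch H0 h0; pose b := `|M| + 1.
have Mb : M < b by rewrite (le_lt_trans (ler_norm M))// ltrDl.
have b0 : 0 < b by rewrite ltr_wpDl.
have -> : Rintegral leb setT h = Rintegral leb `[- b, b] h.
  rewrite [RHS]Rintegral_mkcond; apply: eq_Rintegral => x _; rewrite patchE.
  case: ifPn => // /negP xb; apply: h0; rewrite ltNge; apply/negP => xM.
  apply: xb; rewrite inE /= in_itv/= -ler_norml; exact: le_trans xM (ltW Mb).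
rewrite /Rintegral (continuous_FTC2 (F := H)).
- have [-> ->] : H b = 0 /\ H (- b) = 0 by split; apply: H0; rewrite ?normrN gtr0_norm.
  by rewrite subee.
- by rewrite -subr_gt0 opprK addr_gt0.
- exact: continuous_subspaceT.
- split.
  + by move=> x _; exact: ex_derive.
  + by apply: cvg_at_right_filter; apply: differentiable_continuous; apply/derivable1_diffP; exact: ex_derive.
  + by apply: cvg_at_left_filter; apply: differentiable_continuous; apply/derivable1_diffP; exact: ex_derive.
- by move=> x _; rewrite derive1E; exact: derive_val.
Qed.

End CompactSupport.

Lemma continuous_bigsum {R : realType} {T : topologicalType} (n : nat) (F : 'I_n -> T -> R) :
  (forall i, continuous (F i)) -> continuous (fun x => \sum_(i < n) F i x).
Proof.
move=> cF; elim: (index_enum 'I_n) => [|i r IH].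
  by under eq_fun do rewrite big_nil; move=> x; exact: cvg_cst.
by under eq_fun do rewrite big_cons; move=> x; apply: cvgD; [exact: cF|exact: IH].
Qed.

Lemma continuous_section1 {R : realType} (f : R * R -> R) t :
  continuous f -> continuous (fun x => f (x, t)).
Proof.
move=> cf x; apply: (@continuous_comp _ _ _ (fun x => (x, t)) f x); last exact: cf.
by apply: (@cvg_pair _ _ _ (nbhs x) (nbhs x) (nbhs t) _ _ _ id (fun=> t)); [exact: cvg_id|exact: cvg_cst].
Qed.

Lemma continuous_section2 {R : realType} (f : R * R -> R) x :
  continuous f -> continuous (fun t => f (x, t)).
Proof.
move=> cf t; apply: (@continuous_comp _ _ _ (fun t => (x, t)) f t); last exact: cf.
by apply: (@cvg_pair _ _ _ (nbhs t) (nbhs x) (nbhs t) _ _ _ (fun=> x) id); [exact: cvg_cst|exact: cvg_id].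
Qed.

(** Component [i] of the row vector phi_t^T + phi_x^T A + kappa phi^T Q, up to sign the formal
    adjoint of the equation applied to phi. The matrices stand on the right, as in the weak
    formulation, so pairing with a solution needs no transposition. *)
Definition residual {R : realType} {n} (A Q : 'M[R]_n) (kappa : R -> R)
    (phi : 'I_n -> R -> R -> R) (i : 'I_n) (x t : R) : R :=
  partial_t (phi i) x t + \sum_j partial_x (phi j) x t * A j i
  + kappa x * \sum_j phi j x t * Q j i.

Section EnergyEstimate.
Context {R : realType} {n : nat}.
Local Notation leb := (@lebesgue_measure R).
Variables (A Q : 'M[R]_n) (kappa : R -> R) (K : R).
Hypothesis A_sym : A^T = A.
Hypothesis Q_le0 : forall v : 'I_n -> R, \sum_i (\sum_j v j * Q j i) * v i <= 0.
Hypothesis measurable_kappa : measurable_fun setT kappa.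
Hypothesis kappa_bound : forall x, 0 <= kappa x <= K.
Variables (phi : 'I_n -> R -> R -> R) (M : R).
Hypothesis sphi : forall i, smooth2 (phi i).
Hypothesis phi0 : forall i, supported_in M (phi i).

Local Notation psi := (residual A Q kappa phi).

Let sphix i : smooth2 (partial_x (phi i)). Proof. exact: smooth2_partial_x. Qed.
Let sphit i : smooth2 (partial_t (phi i)). Proof. exact: smooth2_partial_t. Qed.
Let phix0 i : supported_in M (partial_x (phi i)). Proof. exact: supported_in_partial_x. Qed.
Let phit0 i : supported_in M (partial_t (phi i)). Proof. exact: supported_in_partial_t. Qed.

Lemma residual_supported i : supported_in M (psi i).
Proof.
move=> x t xt; rewrite /residual phit0// !big1 ?mulr0 ?addr0// => j _.
  by rewrite phi0// mul0r.
by rewrite phix0// mul0r.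
Qed.

Lemma residual_measurable i : measurable_fun setT (fun p : R * R => psi i p.1 p.2).
Proof.
apply: measurable_funD; first apply: measurable_funD.
- exact: smooth2_measurable.
- apply: measurable_sum => j; apply: measurable_funM => //; exact: smooth2_measurable.
- apply: measurable_funM; first exact: measurableT_comp.
  apply: measurable_sum => j; apply: measurable_funM => //; exact: smooth2_measurable.
Qed.

(** The residual is not continuous when [kappa] jumps, so compactness is applied to each smooth
    factor times [w], and [kappa] is bounded apart. The factor [w] serves for the Gaussian weight,
    which is unbounded on the plane. *)
Lemma residual_bounded_by_continuous (w : R * R -> R) : continuous w ->
  exists C, forall i x t, `|psi i x t * w (x, t)| <= C.
Proof.
move=> cw.
have bnd f : smooth2 f -> supported_in M f -> exists C, forall x t, `|f x t * w (x, t)| <= C.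
  move=> sf f0.
  have cfw : continuous (fun p => f p.1 p.2 * w p).
    by move=> p; apply: cvgM; [exact: smooth2_continuous|exact: cw].
  have [|C fC] := continuous2_bounded (M := M) cfw.
    by move=> x t xt /=; rewrite f0// mul0r.
  by exists C => x t; exact: (fC (x, t)).
have /choice[c hc] i := bnd _ (sphi i) (phi0 i).
have /choice[cx hcx] i := bnd _ (sphix i) (phix0 i).
have /choice[ct hct] i := bnd _ (sphit i) (phit0 i).
pose B i := ct i + \sum_j cx j * `|A j i| + K * \sum_j c j * `|Q j i|.
have psiB i x t : `|psi i x t * w (x, t)| <= B i.
  rewrite /residual !mulrDl (le_trans (ler_normD _ _))// lerD//.
    rewrite (le_trans (ler_normD _ _))// lerD// mulr_suml.
    rewrite (le_trans (ler_norm_sum _ _ _))// ler_sum// => j _.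
    by rewrite mulrAC normrM ler_wpM2r.
  rewrite -mulrA normrM ler_pM//.
    by have /andP[k0 kK] := kappa_bound x; rewrite ger0_norm.
  rewrite mulr_suml (le_trans (ler_norm_sum _ _ _))// ler_sum// => j _.
  by rewrite mulrAC normrM ler_wpM2r.
exists (\sum_i B i) => i x t; rewrite (le_trans (psiB i x t))//.
rewrite (bigD1 i)//= lerDl sumr_ge0// => j _; exact: le_trans (psiB j x t).
Qed.

Lemma residual_bounded : exists C, forall i x t, `|psi i x t| <= C.
Proof.
have [|C psiC] := @residual_bounded_by_continuous (fun=> 1); first by move=> p; exact: cvg_cst.
by exists C => i x t; have := psiC i x t; rewrite mulr1.
Qed.

Lemma smooth2_section_measurable f t : smooth2 f -> measurable_fun setT (f^~ t : R -> R).
Proof.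
by move=> sf; exact: (measurable_fun_pair1 t (smooth2_measurable sf)).
Qed.

Lemma test_square_integrable f t : smooth2 f -> supported_in M f ->
  square_integrable leb (f^~ t).
Proof.
move=> sf f0; have [C fC] := smooth2_bounded sf f0.
apply: (@bounded_support_square_integrable _ _ M C) => //.
  exact: smooth2_section_measurable.
by move=> x xM; apply: f0; left.
Qed.

Lemma residual_square_integrable i t : square_integrable leb (psi i ^~ t).
Proof.
have [C psiC] := residual_bounded.
apply: (@bounded_support_square_integrable _ _ M C) => //.
  exact: (measurable_fun_pair1 t (residual_measurable i)).
by move=> x xM; apply: residual_supported; left.
Qed.

Let S t : square_integrables leb (fun i => phi i ^~ t).
Proof. by move=> i; exact: test_square_integrable. Qed.

Let St t : square_integrables leb (fun i => partial_t (phi i) ^~ t).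
Proof. by move=> i; exact: test_square_integrable. Qed.

Let Spsi t : square_integrables leb (fun i => psi i ^~ t).
Proof. by move=> i; exact: residual_square_integrable. Qed.

Let N t := inner leb (fun i => phi i ^~ t) (fun i => phi i ^~ t).
Let dN t := 2 * inner leb (fun i => phi i ^~ t) (fun i => partial_t (phi i) ^~ t).
Let q t := Num.sqrt (inner leb (fun i => psi i ^~ t) (fun i => psi i ^~ t)).

Let D x t := \sum_i (2 * (phi i x t * partial_t (phi i) x t)).

Let cD : continuous (fun p => D p.1 p.2).
Proof.
apply: continuous_bigsum => i p; apply: cvgMl_tmp; apply: cvgM.
  exact: (smooth2_continuous (sphi i)).
exact: (smooth2_continuous (sphit i)).
Qed.

Let D0 x t : M < `|x| \/ M < `|t| -> D x t = 0.
Proof. by move=> xt; rewrite /D big1// => i _; rewrite phi0// mul0r mulr0. Qed.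

Let D_bounded : exists C, forall x t, `|D x t| <= C.
Proof.
have [|C DC] := continuous2_bounded (M := M) cD; first by move=> x t; exact: D0.
by exists C => x t; exact: (DC (x, t)).
Qed.

Let dNE t : dN t = Rintegral leb setT (D ^~ t).
Proof.
rewrite /dN /inner -RintegralZl//; last exact: square_integrables_integrable.
by apply: eq_Rintegral => x _; rewrite mulr_sumr.
Qed.

Let is_derive_sqr (x t : R) : is_derive t 1 (fun s => \sum_i phi i x s * phi i x s) (D x t).
Proof.
have -> : (fun s => \sum_i phi i x s * phi i x s) = \sum_i ((phi i x) * (phi i x)).
  by apply/funext => s; rewrite fct_sumE.
rewrite /D; apply: is_derive_sum => i.
have dphi : is_derive t 1 (phi i x) (partial_t (phi i) x t).
  by rewrite /partial_t derive1E; apply: DeriveDef => //; exact: smooth2_derivable_t.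
apply: (is_derive_eq (is_deriveM dphi dphi)).
by rewrite /GRing.scale/=; ring.
Qed.

(** One integrable bound valid for all times serves both differentiation under the integral and
    continuity of the derivative. *)
Let dominating : exists G : R -> R, [/\ forall x, 0 <= G x,
  leb.-integrable setT (EFin \o G) & forall x t, `|D x t| <= G x].
Proof.
have [C DC] := D_bounded.
exists (fun x => `|C| * \1_(`[- M, M]) x); split.
- by move=> x; rewrite mulr_ge0.
- have := integrableZl measurableT `|C| (integrable_indic_itv (- M) M true false).
  exact: eq_integrable.
- move=> x t; have [xM|xM] := ltP M `|x|; first by rewrite D0 ?normr0 ?mulr_ge0//; left.
  rewrite indicE mem_set ?mulr1 ?(le_trans (DC x t)) ?ler_norm//.
  by rewrite /= in_itv/= -ler_norml.
Qed.

Let is_derive_N (t : R) : is_derive t 1 N (dN t).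
Proof.
have [G [G0 iG DG]] := dominating.
have It : [set` `]t - 1, t + 1[] t by rewrite /= in_itv/=; apply/andP; split; lra.
have iN s : [set` `]t - 1, t + 1[] s ->
    leb.-integrable setT (EFin \o (fun x => \sum_i phi i x s * phi i x s)).
  by move=> _; exact: square_integrables_integrable.
have dF s x : [set` `]t - 1, t + 1[] s -> setT x ->
    derivable (fun s => \sum_i phi i x s * phi i x s) s 1.
  by move=> _ _; exact: ex_derive.
have GF s x : [set` `]t - 1, t + 1[] s -> setT x ->
    `|partial1of2 (fun s x => \sum_i phi i x s * phi i x s) s x| <= G x.
  by move=> _ _; rewrite partial1of2E (@derive_val _ _ _ _ _ _ _ (is_derive_sqr x s)).
apply: DeriveDef; first exact: (derivable_under_integral measurableT It iN dF G0 iG GF).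
rewrite -derive1E (differentiation_under_integral measurableT It iN dF G0 iG GF) dNE.
apply: eq_Rintegral => x _.
by rewrite partial1of2E (@derive_val _ _ _ _ _ _ _ (is_derive_sqr x t)).
Qed.

(** Needed for the fundamental theorem of calculus in [energy_estimate]. *)
Let continuous_dN : continuous dN.
Proof.
have [G [G0 iG DG]] := dominating.
have [C DC] := D_bounded.
have -> : dN = fun t => Rintegral leb setT (D ^~ t) by apply/funext.
have iD (s : R) : leb.-integrable setT (EFin \o (D ^~ s)).
  apply: (@bounded_support_integrable _ _ M C) => //.
    exact: (measurable_fun_pair1 s (continuous2_measurable cD)).
  by move=> x xM; apply: D0; left.
have cDx x : continuous (D x) by exact: continuous_section2 cD.
move=> t.
have iD' s : [set` `]t - 1, t + 1[] s -> leb.-integrable setT (EFin \o (D ^~ s)) by [].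
have tI : t \in [set` `]t - 1, t + 1[] by rewrite inE /= in_itv/=; apply/andP; split; lra.
refine (@continuity_under_integral _ _ (measurableTypeR R) _ (fun s x => D x s) _ measurableT _ _ iD' _ _ iG _ t tI).
  by apply/aeW => x _ s _; exact: cDx.
by move=> s _; apply/aeW => x _.
Qed.

(** Pairing the residual with phi and doubling gives [dN], plus the integral of the x-derivative of
    phi^T A phi, which is 0 by compact support, plus twice the integral of kappa phi^T Q phi, which
    is nonpositive. *)
Let inner_derivative_ge t : 2 * inner leb (fun i => phi i ^~ t) (fun i => psi i ^~ t) <= dN t.
Proof.
(* The energy flux phi^T A phi and its derivative by the product rule. Symmetry of [A] merges the
   two halves of [h] into twice the transport term of the residual, which is [hE]. *)
pose H x := \sum_i \sum_j A j i * (phi i x t * phi j x t).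
pose h x := \sum_i \sum_j A j i * (phi i x t * partial_x (phi j) x t + phi j x t * partial_x (phi i) x t).
have ch : continuous h.
  have cs f : smooth2 f -> continuous (f^~ t).
    by move=> sf; exact: continuous_section1 (smooth2_continuous sf).
  apply: continuous_bigsum => i; apply: continuous_bigsum => j x.
  by apply: cvgMl_tmp; apply: cvgD; apply: cvgM; apply: cs.
have dH (x : R) : is_derive x 1 H (h x).
  have -> : H = \sum_i \sum_j (A j i *: ((phi i ^~ t) * (phi j ^~ t))).
    by apply/funext => y; rewrite fct_sumE; apply: eq_bigr => i _; rewrite fct_sumE.
  rewrite /h; apply: is_derive_sum => i; apply: is_derive_sum => j.
  have dphi k : is_derive x 1 (phi k ^~ t) (partial_x (phi k) x t).
    by rewrite /partial_x derive1E; apply: DeriveDef => //; exact: smooth2_derivable_x.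
  exact: (is_derive_eq (is_deriveZ _ (is_deriveM (dphi i) (dphi j)))).
have h0 : Rintegral leb setT h = 0.
  apply: (Rintegral_derive1_eq0 (M := M) dH ch) => x xM.
    by rewrite /H big1// => i _; rewrite big1// => j _; rewrite phi0 ?mul0r ?mulr0//; left.
  rewrite /h big1// => i _; rewrite big1// => j _.
  by rewrite !phi0 ?mul0r ?addr0 ?mulr0//; left.
have hE x : h x = 2 * \sum_i phi i x t * (\sum_j partial_x (phi j) x t * A j i).
  transitivity (\sum_i \sum_j A j i * (phi i x t * partial_x (phi j) x t) +
      \sum_i \sum_j A j i * (phi j x t * partial_x (phi i) x t)).
    by rewrite -big_split; apply: eq_bigr => i _; rewrite -big_split; apply: eq_bigr => j _; rewrite mulrDr.
  rewrite [X in _ + X]exchange_big /= [RHS]mulr_natl mulr2n; congr (_ + _); apply: eq_bigr => i _.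
    by rewrite mulr_sumr; apply: eq_bigr => j _; ring.
  rewrite mulr_sumr; apply: eq_bigr => j _; have := congr1 (fun B : matrix R n n => B i j) A_sym.
  by rewrite mxE => ->; ring.
have ih : leb.-integrable setT (EFin \o h).
  have sg : square_integrables leb (fun i x => \sum_j partial_x (phi j) x t * A j i).
    move=> i; apply: square_integrable_sum => j.
    under eq_fun do rewrite mulrC.
    by apply: square_integrableZ; exact: test_square_integrable.
  have := integrableZl measurableT 2 (square_integrables_integrable (S t) sg).
  by apply: eq_integrable => // x _; rewrite -[RHS]/((h x)%:E) hE.
have iphipsi := square_integrables_integrable (S t) (Spsi t).
have iphit := square_integrables_integrable (S t) (St t).
(* Half the integral of [h], which is 0, is subtracted so that the inequality becomes pointwise:
   only the dissipative term is left. *)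
rewrite /dN ler_pM2l// -[leLHS]subr0 -(mulr0 2^-1) -h0 -RintegralZl// /inner -RintegralB//; last first.
  by have := integrableZl measurableT 2^-1 ih.
apply: le_Rintegral => //.
  have := integrableB measurableT iphipsi (integrableZl measurableT 2^-1 ih).
  exact: eq_integrable.
move=> x _; rewrite -/(h x) hE mulrA mulVf ?mul1r// -sumrB.
rewrite -subr_ge0 -sumrB.
rewrite (eq_bigr (fun i => - kappa x * ((\sum_j phi j x t * Q j i) * phi i x t))) => [|i _]; last first.
  by rewrite /residual; ring.
rewrite -mulr_sumr mulNr -mulrN mulr_ge0 ?oppr_ge0//; first by have /andP[] := kappa_bound x.
Qed.

(** Since [kappa] may jump, measurability in time comes from Tonelli's theorem rather than from
    continuity. *)
Let inner_psi_measurable : measurable_fun setT (fun t => inner leb (fun i => psi i ^~ t) (fun i => psi i ^~ t)).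
Proof.
apply: measurableT_comp => //.
pose F (p : R * R) := (\sum_i psi i p.1 p.2 * psi i p.1 p.2)%:E.
have mF : measurable_fun setT F.
  apply/measurable_EFinP; apply: measurable_sum => i.
  by apply: measurable_funM; exact: residual_measurable.
have F0 p : (0 <= F p)%E by rewrite lee_fin sumr_ge0// => i _; rewrite -expr2 sqr_ge0.
exact: (@measurable_fun_fubini_tonelli_G _ _ (measurableTypeR R) (measurableTypeR R) R leb F mF F0).
Qed.

Let q_measurable : measurable_fun setT q.
Proof.
apply: measurableT_comp inner_psi_measurable.
by apply: continuous_measurable_fun; exact: sqrt_continuous.
Qed.

Let q0 t : M < `|t| -> q t = 0.
Proof.
move=> tM; rewrite /q /inner -[RHS]sqrtr0; congr Num.sqrt.
transitivity (Rintegral leb setT (fun=> 0)); last by rewrite /Rintegral integral0.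
by apply: eq_Rintegral => x _; rewrite big1// => i _; rewrite residual_supported ?mul0r//; right.
Qed.

Lemma energy_integrable : leb.-integrable setT (EFin \o q).
Proof.
have [C psiC] := residual_bounded.
(* Each of the [n] components is at most [C] in absolute value, and all vanish for |x| > M. *)
pose B x := `|n%:R * (C * C)| * \1_(`[- M, M]) x.
have iB : leb.-integrable setT (EFin \o B).
  have := integrableZl measurableT `|n%:R * (C * C)| (integrable_indic_itv (- M) M true false).
  exact: eq_integrable.
apply: (@bounded_support_integrable _ _ M (Num.sqrt (Rintegral leb setT B))) => //.
move=> t; rewrite ger0_norm ?sqrtr_ge0// ler_wsqrtr//.
apply: le_Rintegral => //; first exact: square_integrables_integrable.
move=> x _; rewrite /B indicE; have [xM|xM] := ltP M `|x|.
  rewrite big1 ?mulr_ge0// => i _.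
  by rewrite residual_supported ?mul0r//; left.
rewrite mem_set ?mulr1; last by rewrite /= in_itv/= -ler_norml.
apply: le_trans (ler_norm _); rewrite mulr_natl -[in leRHS](card_ord n) -sumr_const.
apply: ler_sum => i _; rewrite -expr2 -real_normK ?num_real// expr2 ler_pM//.
Qed.

(** The norm of phi(., t) vanishes past the support and its derivative is at least - q, so
    integrating back from there to time 0 bounds its value at 0 by the integral of [q]. *)
Lemma energy_estimate : Num.sqrt (N 0) <= Rintegral leb `]0, +oo[ q.
Proof.
apply/ler_addgt0Pr => e e0.
(* [sqrt N] need not be differentiable where [N] vanishes. *)
pose s t := Num.sqrt (N t + e ^+ 2).
have Npos t : 0 < N t + e ^+ 2 by rewrite ltr_wpDl ?inner_ge0// exprn_gt0.
pose ds t := (2 * s t)^-1 * dN t.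
have s_gt0 t : 0 < s t by rewrite sqrtr_gt0.
have dsP (t : R) : is_derive t 1 s (ds t).
  have h1 : is_derive t 1 (fun t => N t + e ^+ 2) (dN t).
    by have := is_deriveD (is_derive_N t) (is_derive_cst (e ^+ 2) t 1); rewrite addr0.
  have h2 := is_derive1_sqrt (Npos t).
  exact: (@is_derive1_comp _ Num.sqrt (fun t => N t + e ^+ 2) t _ _ h2 h1).
have cs : continuous s.
  by move=> t; apply: differentiable_continuous; apply/derivable1_diffP; exact: ex_derive.
have cds : continuous ds.
  move=> t; apply: cvgM; last exact: continuous_dN.
  apply: cvgV; first by rewrite mulf_neq0 ?gt_eqF.
  by apply: cvgMl_tmp; exact: cs.
pose b := `|M| + 1.
have Mb : M < b by rewrite (le_lt_trans (ler_norm M))// ltrDl.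
have b0 : 0 < b by rewrite ltr_wpDl.
have Nb : N b = 0.
  rewrite /N /inner; transitivity (Rintegral leb setT (fun=> 0)); last by rewrite /Rintegral integral0.
  by apply: eq_Rintegral => x _; rewrite big1// => i _; rewrite phi0 ?mul0r//; right; rewrite gtr0_norm.
(* By [inner_derivative_ge] and Cauchy-Schwarz, dN >= - 2 sqrt N q, and sqrt N <= s; dividing by 2 s
   gives the claim. *)
have dsq t : - q t <= ds t.
  rewrite /ds mulrC ler_pdivlMr ?mulr_gt0//.
  apply: le_trans (inner_derivative_ge t).
  have := inner_le_sqrt (S t) (Spsi t); rewrite ler_norml => /andP[h _].
  have sN : Num.sqrt (N t) <= s t by rewrite ler_wsqrtr// lerDl sqr_ge0.
  have q_ge0 : 0 <= q t by exact: sqrtr_ge0.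
  have : Num.sqrt (N t) * q t <= s t * q t by rewrite ler_wpM2r.
  move: h; rewrite -/(N t) -/(q t); move: (inner _ _ _) => w h1 h2; nra.
have ftc : Rintegral leb `[0, b] ds = s b - s 0.
  rewrite /Rintegral (continuous_FTC2 (F := s))//.
  - exact: continuous_subspaceT.
  - split.
    + by move=> x _; exact: ex_derive.
    + by apply: cvg_at_right_filter; exact: cs.
    + by apply: cvg_at_left_filter; exact: cs.
  - by move=> x _; rewrite derive1E; exact: derive_val.
have ids : leb.-integrable `[0, b] (EFin \o ds).
  by apply: continuous_compact_integrable; [exact: segment_compact|exact: continuous_subspaceT].
have iq := energy_integrable.
have iq0b : leb.-integrable `[0, b] (EFin \o q) by exact: integrableS iq.
have : - Rintegral leb `[0, b] q <= Rintegral leb `[0, b] ds.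
  rewrite -mulN1r -RintegralZl//; apply: le_Rintegral => //.
    have iNq := integrableZl measurableT (-1) iq.
    exact: integrableS iNq.
  by move=> t _; rewrite mulN1r; exact: dsq.
(* [q] vanishes past [b], and the endpoint 0 has measure zero. *)
have -> : Rintegral leb `[0, b] q = Rintegral leb `]0, +oo[ q.
  rewrite -Rintegral_itv_obnd_cbnd; last exact: integrableS iq.
  rewrite Rintegral_mkcond [RHS]Rintegral_mkcond; apply: eq_Rintegral => t _.
  rewrite !patchE; case: ifPn => [/set_mem/=|/negP tb].
    by rewrite in_itv/= => /andP[t0 _]; rewrite mem_set//= in_itv/= t0.
  case: ifPn => // /set_mem/=; rewrite in_itv/= andbT => t0.
  rewrite -/(q t) q0//; apply: (lt_trans Mb); rewrite gtr0_norm// ltNge; apply/negP => tb'.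
  by apply: tb; rewrite inE/= in_itv/= t0.
rewrite ftc /s Nb add0r sqrtr_sqr (ger0_norm (ltW e0)).
have : Num.sqrt (N 0) <= Num.sqrt (N 0 + e ^+ 2) by rewrite ler_wsqrtr// lerDl sqr_ge0.
by move=> *; lra.
Qed.

End EnergyEstimate.

(** * The dual of the mixed norm *)

Section MixedNorm.
Context d1 d2 (T1 : measurableType d1) (T2 : measurableType d2) (R : realType).
Variables (P1 : probability T1 R) (P2 : probability T2 R) (D : set T2).
Hypothesis mD : measurable D.
Context {n : nat}.
Local Notation PP := (P1 \x P2)%E.
Implicit Types f g : 'I_n -> T1 * T2 -> R.

Definition bounded_family f := forall i, bounded_measurable (f i).

Definition slice f (t : T2) := fun i x => f i (x, t).

Definition slice_norm f t := Num.sqrt (inner P1 (slice f t) (slice f t)).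

Definition mixed_norm f := Rintegral P2 D (slice_norm f).

Lemma slice_bounded_measurable (h : T1 * T2 -> R) t :
  bounded_measurable h -> bounded_measurable (fun x => h (x, t)).
Proof.
move=> [mh [M hM]]; split; last by exists M.
exact: measurable_fun_pair1.
Qed.

Lemma bounded_measurable_square_integrable d (T : measurableType d)
    (P : probability T R) (h : T -> R) : bounded_measurable h -> square_integrable P h.
Proof.
move=> bh; split; first by case: bh.
by apply: bounded_measurable_integrable; exact: bounded_measurableM.
Qed.

Lemma slice_square_integrables f t : bounded_family f -> square_integrables P1 (slice f t).
Proof.
move=> bf i; apply: bounded_measurable_square_integrable.
exact: slice_bounded_measurable.
Qed.

Let sqr_sum f p := \sum_i f i p * f i p.

Let sqr_sum_ge0 f p : 0 <= sqr_sum f p.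
Proof. by apply: sumr_ge0 => i _; rewrite -expr2 sqr_ge0. Qed.

Let sqr_sum_bounded f : bounded_family f -> bounded_measurable (sqr_sum f).
Proof. by move=> bf; apply: bounded_measurable_sum => i; exact: bounded_measurableM. Qed.

Lemma inner_slice_EFin f t : bounded_family f ->
  (\int[P1]_x (\sum_i f i (x, t) * f i (x, t))%:E)%E =
  (inner P1 (slice f t) (slice f t))%:E.
Proof.
move=> bf; rewrite /inner /Rintegral fineK//.
apply: (@integrable_fin_num _ _ _ P1 setT measurableT).
by have := square_integrables_integrable (slice_square_integrables t bf) (slice_square_integrables t bf).
Qed.

Lemma inner_slice_bounded f : bounded_family f ->
  bounded_measurable (fun t => inner P1 (slice f t) (slice f t)).
Proof.
move=> bf; have [mF [C FC]] := sqr_sum_bounded bf.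
split.
  apply: measurableT_comp => //.
  apply: (@measurable_fun_fubini_tonelli_G _ _ T1 T2 R P1 (EFin \o sqr_sum f)).
    exact/measurable_EFinP.
  by move=> p; rewrite lee_fin.
exists C => t; rewrite ger0_norm ?inner_ge0//.
have P1E : fine (P1 setT) = 1 by rewrite probability_setT.
rewrite -[leRHS]mulr1 -P1E -Rintegral_cst//; apply: le_Rintegral => //.
- exact: square_integrables_integrable (slice_square_integrables t bf) (slice_square_integrables t bf).
- exact: finite_measure_integrable_cst.
- by move=> x _; exact: le_trans (ler_norm _) (FC (x, t)).
Qed.

Lemma slice_norm_bounded f : bounded_family f -> bounded_measurable (slice_norm f).
Proof.
move=> bf; have [mi [C iC]] := inner_slice_bounded bf; split.
  by apply: measurableT_comp mi; apply: continuous_measurable_fun; exact: sqrt_continuous.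
exists (Num.sqrt C) => t; rewrite ger0_norm ?sqrtr_ge0// ler_wsqrtr//.
exact: le_trans (ler_norm _) (iC t).
Qed.

Lemma slice_norm_integrable f : bounded_family f -> P2.-integrable D (EFin \o slice_norm f).
Proof.
move=> bf; apply: (integrableS measurableT mD) => //.
exact: bounded_measurable_integrable (slice_norm_bounded bf).
Qed.

Lemma mixed_normD f g : bounded_family f -> bounded_family g ->
  mixed_norm (fun i p => f i p + g i p) <= mixed_norm f + mixed_norm g.
Proof.
move=> bf bg.
have bfg : bounded_family (fun i p => f i p + g i p) by move=> i; exact: bounded_measurableD.
rewrite /mixed_norm -RintegralD//; [|exact: slice_norm_integrable..].
apply: le_Rintegral => //; first exact: slice_norm_integrable.
  by have := integrableD mD (slice_norm_integrable bf) (slice_norm_integrable bg).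
move=> t _; exact: inner_Minkowski (slice_square_integrables t bf) (slice_square_integrables t bg).
Qed.

Lemma mixed_normZ c f : bounded_family f ->
  mixed_norm (fun i p => c * f i p) = `|c| * mixed_norm f.
Proof.
move=> bf; rewrite /mixed_norm -RintegralZl//; last exact: slice_norm_integrable.
apply: eq_Rintegral => t _; rewrite /slice_norm.
have sf := slice_square_integrables t bf.
have sZ : square_integrables P1 (fun i x => c * slice f t i x).
  by move=> i; exact: square_integrableZ.
rewrite [X in Num.sqrt X](_ : _ = inner P1 (fun i x => c * slice f t i x) (fun i x => c * slice f t i x))//.
rewrite innerZl// innerC innerZl// mulrA -expr2 sqrtrM ?sqr_ge0//.
by rewrite sqrtr_sqr.
Qed.

Lemma Rintegral_inner_slice f : bounded_family f ->
  Rintegral PP setT (fun p => \sum_i f i p * f i p) =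
  Rintegral P2 setT (fun t => inner P1 (slice f t) (slice f t)).
Proof.
move=> bf; rewrite /Rintegral; congr fine.
have [mF _] := sqr_sum_bounded bf.
rewrite (@fubini_tonelli2 _ _ _ _ _ P1 P2 (EFin \o sqr_sum f)); last 2 first.
- exact/measurable_EFinP.
- by move=> p; rewrite lee_fin.
by apply: eq_integral => t _; rewrite -inner_slice_EFin.
Qed.

(** Cauchy-Schwarz in time against the indicator of [D], whose L^2 norm is at most 1. A functional
    dominated by the mixed norm thus meets the L^2 hypothesis of [Radon_Nikodym_representation]. *)
Lemma mixed_norm_le f : bounded_family f ->
  mixed_norm f ^+ 2 <= Rintegral PP setT (fun p => \sum_i f i p * f i p).
Proof.
move=> bf; rewrite Rintegral_inner_slice//.
have bs := slice_norm_bounded bf.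
(* Families with a single member turn the vector form of Cauchy-Schwarz into the scalar one. *)
pose u := fun (_ : 'I_1) t => slice_norm f t; pose v := fun (_ : 'I_1) (t : T2) => \1_D t : R.
have su : square_integrables P2 u by move=> i; exact: bounded_measurable_square_integrable.
have sv : square_integrables P2 v.
  by move=> i; apply: bounded_measurable_square_integrable; exact: bounded_measurable_indic.
have -> : mixed_norm f = inner P2 u v.
  rewrite /mixed_norm Rintegral_mkcond; apply: eq_Rintegral => t _.
  by rewrite big_ord1 /u /v patchE indicE; case: (_ \in _); rewrite ?mulr1 ?mulr0.
apply: le_trans (inner_CauchySchwarz su sv) _.
have -> : inner P2 u u = Rintegral P2 setT (fun t => inner P1 (slice f t) (slice f t)).
  apply: eq_Rintegral => t _; rewrite big_ord1 /u /slice_norm -expr2 sqr_sqrtr//.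
  exact: inner_ge0.
rewrite ler_piMr//.
  by apply: Rintegral_ge0 => t _; exact: inner_ge0.
have P2E : fine (P2 setT) = 1 by rewrite probability_setT.
rewrite -P2E -[leRHS]mul1r -Rintegral_cst//; apply: le_Rintegral => //.
- exact: square_integrables_integrable.
- exact: finite_measure_integrable_cst.
- move=> t _; rewrite big_ord1 /v indicE; case: (_ \in _); by rewrite ?mulr1 ?mulr0.
Qed.

End MixedNorm.

Section DualOfMixedNorm.
Context d1 d2 (T1 : measurableType d1) (T2 : measurableType d2) (R : realType).
Variables (P1 : probability T1 R) (P2 : probability T2 R) (D : set T2).
Hypothesis mD : measurable D.
Context {n : nat} (K : R).
Hypothesis K0 : 0 <= K.
Local Notation PP := (P1 \x P2)%E.
Local Notation family := ('I_n -> T1 * T2 -> R^o).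
Local Notation norm_D := (mixed_norm P1 P2 D).

(** The Hahn-Banach extension of [L] to all bounded families is represented one coordinate at a
    time, by restricting it to families with a single nonzero component. Domination survives the
    representation, since the extension and the sum of integrals agree on bounded families. *)
Lemma mixed_norm_dual (L : set (family * R)) :
  L (0, 0) ->
  (forall a b, L a -> L b -> L (a.1 + b.1, a.2 + b.2)) ->
  (forall c a, L a -> L (c *: a.1, c * a.2)) ->
  (forall a, L a -> bounded_family a.1 /\ a.2 <= K * norm_D a.1) ->
  exists V : family, [/\ forall i, PP.-integrable setT (EFin \o V i),
    forall a, L a -> \sum_i Rintegral PP setT (fun p => a.1 i p * V i p) = a.2 &
    forall f : family, bounded_family f ->
      \sum_i Rintegral PP setT (fun p => f i p * V i p) <= K * norm_D f].
Proof.
move=> L0 LD LZ Lb.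
pose X : set family := [set f | bounded_family f].
have X0 : X 0 by move=> i; exact: (bounded_measurable_cst (0 : R)).
have XD (f g : family) : X f -> X g -> X (f + g).
  by move=> bf bg i; exact: bounded_measurableD.
have XZ c (f : family) : X f -> X (c *: f) by move=> bf i; exact: bounded_measurableZ.
have sp : sublinear_on X (fun f => K * norm_D f).
  split=> [f g bf bg|c f bf c0].
    by rewrite -mulrDr ler_wpM2l//; exact: mixed_normD.
  rewrite mulrCA; congr (_ * _).
  by have := mixed_normZ P1 P2 mD c bf; rewrite (ger0_norm c0).
have [g [gD gZ gp gL]] := Hahn_Banach_graph X0 XD XZ sp L0 LD LZ Lb.
pose inj i (h : T1 * T2 -> R) : family := fun j p => (j == i)%:R * h p.
have binj i h : bounded_measurable h -> X (inj i h).
  by move=> bh j; exact: bounded_measurableZ.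
have gabs f : X f -> `|g f| <= K * norm_D f.
  move=> bf; rewrite ler_norml gp// andbT.
  have := gp _ (XZ (-1) f bf); rewrite gZ//.
  have := mixed_normZ P1 P2 mD (-1) bf; rewrite normrN1 mul1r => h.
  rewrite -[X in _ <= K * X -> _]/(norm_D (fun i p => -1 * f i p)) h mulN1r => h2.
  by rewrite lerNl.
have comp i : exists V : T1 * T2 -> R, PP.-integrable setT (EFin \o V) /\
    forall h, bounded_measurable h -> g (inj i h) = Rintegral PP setT (fun p => h p * V p).
  (* [K ^+ 2] arises by squaring the bound by [K] times the mixed norm, then applying
     [mixed_norm_le]. *)
  apply: (@Radon_Nikodym_representation _ _ _ (P1 \x P2)%E (fun h => g (inj i h)) (K ^+ 2)).
  - move=> f h bf bh; rewrite -gD; [|exact: binj..].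
    by congr g; apply/funext => j; apply/funext => p; rewrite /inj mulrDr.
  - move=> a f bf; rewrite -gZ; last exact: binj.
    by congr g; apply/funext => j; apply/funext => p; rewrite /inj mulrCA.
  - move=> f bf; rewrite -real_normK ?num_real//.
    have h := gabs _ (binj i f bf).
    have N0 : 0 <= norm_D (inj i f) by apply: Rintegral_ge0 => t _; exact: sqrtr_ge0.
    have : `|g (inj i f)| ^+ 2 <= (K * norm_D (inj i f)) ^+ 2.
      by rewrite lerXn2r// ?nnegrE ?mulr_ge0.
    move/le_trans; apply; rewrite exprMn ler_wpM2l ?sqr_ge0//.
    apply: le_trans (mixed_norm_le P1 P2 mD (binj i f bf)) _.
    rewrite le_eqVlt; apply/orP; left; apply/eqP; apply: eq_Rintegral => p _.
    rewrite (bigD1 i)//= big1 => [|j ji]; last by rewrite /inj (negbTE ji) !mul0r.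
    by rewrite /inj eqxx !mul1r addr0 expr2.
have [V iV] := choice comp.
have gE (f : family) : X f -> g f = \sum_i Rintegral PP setT (fun p => f i p * V i p).
  move=> bf; rewrite (eq_bigr (fun i => g (inj i (f i)))) => [|i _]; last first.
    by have [_ ->] := iV i.
  have gsum (s : seq 'I_n) : X (\sum_(i <- s) inj i (f i)) /\
      g (\sum_(i <- s) inj i (f i)) = \sum_(i <- s) g (inj i (f i)).
    elim: s => [|i s [Xs gs]].
      by rewrite !big_nil; split => //; rewrite -(scale0r (0 : family)) gZ// mul0r.
    rewrite !big_cons; split; first by apply: XD => //; exact: binj.
    by rewrite gD// ?gs//; exact: binj.
  rewrite -(gsum _).2; congr g; apply/funext => j; apply/funext => p.
  rewrite !fct_sumE (bigD1 j)//= big1 => [|i ij]; last by rewrite /inj eq_sym (negbTE ij) mul0r.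
  by rewrite /inj eqxx mul1r addr0.
exists V; split=> [i|a La|f bf]; first by case: (iV i).
- by rewrite -gE ?gL//; case: (Lb _ La).
- by rewrite -gE//; exact: gp.
Qed.

End DualOfMixedNorm.

Lemma Rintegral_sum d (T : measurableType d) (R : realType)
    (mu : {measure set T -> \bar R}) (I : Type) (s : seq I) (F : I -> T -> R) :
  (forall i, mu.-integrable setT (EFin \o F i)) ->
  \sum_(i <- s) Rintegral mu setT (F i) = Rintegral mu setT (fun x => \sum_(i <- s) F i x).
Proof.
move=> iF; elim: s => [|i s IH].
  rewrite big_nil; under [in RHS]eq_Rintegral do rewrite big_nil.
  by rewrite /Rintegral integral0.
rewrite big_cons; under [in RHS]eq_Rintegral do rewrite big_cons.
rewrite IH RintegralD//.
have := integrable_sum measurableT s (fun i (_ : xpredT i) => iF i).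
by apply: eq_integrable => // x _ /=; rewrite sumEFin.
Qed.

(** * From domination by the mixed norm to a bound at almost every time *)

Section EssentialBound.
Context d1 d2 (T1 : measurableType d1) (T2 : measurableType d2) (R : realType).
Variables (P1 : probability T1 R) (P2 : probability T2 R) (D : set T2).
Hypothesis mD : measurable D.
Context {n : nat} (K : R).
Hypothesis K0 : 0 <= K.
Local Notation PP := (P1 \x P2)%E.
Variable V : 'I_n -> T1 * T2 -> R.
Hypothesis iV : forall i, PP.-integrable setT (EFin \o V i).
Hypothesis V_dual : forall f : 'I_n -> T1 * T2 -> R, bounded_family f ->
  \sum_i Rintegral PP setT (fun p => f i p * V i p) <= K * mixed_norm P1 P2 D f.

Let mV i : measurable_fun setT (V i).
Proof. by apply/measurable_EFinP; exact: measurable_int (iV i). Qed.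

(** [V] is merely integrable, hence not an admissible test family; cutting it off outside [A N]
    bounds all its components at once. *)
Let A (N : nat) : set (T1 * T2) := [set p | \sum_j `|V j p| <= N%:R].

Let mA N : measurable (A N).
Proof.
have -> : A N = setT `&` (fun p => \sum_j `|V j p|) @^-1` `]-oo, N%:R].
  by rewrite setTI; apply/seteqP; split => p; rewrite /A /= in_itv.
have mS : measurable_fun setT (fun p => \sum_j `|V j p|).
  by apply: measurable_sum => j; exact: measurableT_comp.
by apply: mS.
Qed.

Let W N i p := V i p * \1_(A N) p.

Let bW N : bounded_family (W N).
Proof.
move=> i; split; first by apply: measurable_funM => //; exact: measurable_indic.
exists N%:R => p; rewrite /W indicE.
case: (boolP (p \in A N)) => [/set_mem Ap|_]; last by rewrite mulr0 normr0.
rewrite mulr1; apply: le_trans Ap; rewrite (bigD1 i)//= lerDl.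
by apply: sumr_ge0.
Qed.

Let hN N t := inner P1 (slice (W N) t) (slice (W N) t).

Let E N := D `&` [set t | K ^+ 2 < hN N t].

Let mE N : measurable (E N).
Proof.
apply: measurableI => //; have [mh _] := inner_slice_bounded P1 (bW N).
have -> : [set t | K ^+ 2 < hN N t] = setT `&` (hN N) @^-1` `]K ^+ 2, +oo[.
  by rewrite setTI; apply/seteqP; split => t; rewrite /= in_itv/= andbT.
exact: mh.
Qed.

(* Testing against [V] itself, truncated and restricted to the bad times [E N], gives
   [\int_E h <= K \int_E sqrt h] with [h > K ^ 2] on [E]. *)
Let f N i (p : T1 * T2) := W N i p * \1_(E N) p.2.

Let bf N : bounded_family (f N).
Proof.
move=> i; apply: bounded_measurableM; first exact: bW.
have mI : measurable_fun setT (\1_(E N) : T2 -> R) by exact: measurable_indic.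
split; first exact: (measurableT_comp mI measurable_snd).
by exists 1 => p; rewrite indicE; case: (_ \in _); rewrite ?normr1 ?normr0.
Qed.

Let inner_f N t : inner P1 (slice (f N) t) (slice (f N) t) = \1_(E N) t * hN N t.
Proof.
have s := slice_square_integrables P1 t (bW N).
rewrite /hN /inner -RintegralZl//; last exact: square_integrables_integrable.
apply: eq_Rintegral => x _; rewrite mulr_sumr; apply: eq_bigr => i _.
rewrite /slice /f /= indicE; case: (_ \in _); rewrite ?mulr1 ?mul1r ?mulr0 ?mul0r//.
Qed.

(** On [E N] one has sqrt h > K >= 0, so h - K sqrt h = sqrt h (sqrt h - K) is positive there; its
    integral over [E N] is nonpositive, which forces a null set. *)
Let E_negligible N : P2.-negligible (E N).
Proof.
have hN0 t : 0 <= hN N t by exact: inner_ge0.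
pose g t := \1_(E N) t * (hN N t - K * Num.sqrt (hN N t)).
have bh := inner_slice_bounded P1 (bW N).
have bs := slice_norm_bounded P1 (bW N).
have bE := bounded_measurable_indic (R := R) (mE N).
have b1 : bounded_measurable (fun t => \1_(E N) t * hN N t) by exact: bounded_measurableM.
have b2 : bounded_measurable (fun t => \1_(E N) t * (K * Num.sqrt (hN N t))).
  by apply: bounded_measurableM => //; exact: bounded_measurableZ.
have bg : bounded_measurable g.
  have := bounded_measurableD b1 (bounded_measurableZ (-1) b2).
  by congr bounded_measurable; apply/funext => t; rewrite /g; ring.
have g_gt0 t : E N t -> 0 < hN N t - K * Num.sqrt (hN N t).
  move=> [_ /= ht]; have Ks : K < Num.sqrt (hN N t).
    by rewrite -(ltr_pXn2r (ltn0Sn 1)) ?nnegrE ?sqrtr_ge0// sqr_sqrtr.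
  rewrite subr_gt0 -[ltRHS](sqr_sqrtr (hN0 t)) expr2 ltr_pM2r//.
  exact: le_lt_trans K0 Ks.
have g0 t : 0 <= g t.
  rewrite /g indicE; case: (boolP (t \in E N)) => [/set_mem/g_gt0/ltW|_]; last by rewrite mul0r.
  by rewrite mul1r.
have Rg : Rintegral P2 setT g <= 0.
  have := V_dual (bf N).
  rewrite (eq_bigr (fun i => Rintegral PP setT (fun p => f N i p * f N i p))) => [|i _]; last first.
    apply: eq_Rintegral => p _; rewrite /f /W !indicE.
    by case: (_ \in _); case: (_ \in _); rewrite ?mulr1 ?mulr0 ?mul0r.
  rewrite Rintegral_sum; last first.
    by move=> i; apply: bounded_measurable_integrable; apply: bounded_measurableM; exact: bf.
  rewrite (Rintegral_inner_slice P1 P2 (bf N)).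
  have -> : K * mixed_norm P1 P2 D (f N) = Rintegral P2 setT (fun t => \1_(E N) t * (K * Num.sqrt (hN N t))).
    rewrite /mixed_norm Rintegral_mkcond -RintegralZl//.
      apply: eq_Rintegral => t _; rewrite patchE /slice_norm inner_f indicE.
      have [tE|tE] := boolP (t \in E N).
        have -> : t \in D by rewrite inE; case/set_mem: tE.
        by rewrite !mul1r.
      by rewrite !mul0r sqrtr0; case: ifP; rewrite mulr0.
    have := bounded_measurable_integrable P2 (bounded_measurableM bE (slice_norm_bounded P1 (bf N))).
    apply: eq_integrable => // t _; rewrite /= patchE /slice_norm inner_f !indicE; congr EFin.
    have [tE|tE] := boolP (t \in E N).
      have -> : t \in D by rewrite inE; case/set_mem: tE.
      by rewrite !mul1r.
    by rewrite !mul0r sqrtr0; case: ifP.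
  under eq_Rintegral do rewrite inner_f.
  suff -> : Rintegral P2 setT g = Rintegral P2 setT (fun t => \1_(E N) t * hN N t) -
      Rintegral P2 setT (fun t => \1_(E N) t * (K * Num.sqrt (hN N t))) by rewrite subr_le0.
  rewrite -RintegralB//; [|exact: bounded_measurable_integrable..].
  by apply: eq_Rintegral => t _; rewrite /g mulrBr.
have gae : ae_eq P2 setT (EFin \o g) (cst 0%E).
  apply/ae_eq_integral_abs => //; first by apply/measurable_EFinP; case: bg.
  transitivity ((Rintegral P2 setT g)%:E).
    rewrite /Rintegral fineK; last first.
      apply: (@integrable_fin_num _ _ _ P2 setT measurableT).
      exact: bounded_measurable_integrable.
    by apply: eq_integral => t _; rewrite /= ger0_norm.
  congr EFin; apply/eqP; rewrite eq_le Rg/=; by apply: Rintegral_ge0 => t _; exact: g0.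
apply: negligibleS gae => t Et /= /(_ I)[gt0].
have := g_gt0 _ Et; suff -> : hN N t - K * Num.sqrt (hN N t) = 0 by rewrite ltxx.
by rewrite -gt0 /g indicE mem_set// mul1r.
Qed.

(** Outside the countable union of the sets [E N] every truncated slice obeys the bound, and
    monotone convergence removes the truncation. *)
Lemma essential_slice_bound :
  P2.-negligible (D `&` [set t |
    ((K ^+ 2)%:E < \int[P1]_x (\sum_i V i (x, t) * V i (x, t))%:E)%E]).
Proof.
apply: (negligibleS _ (negligible_bigcup E_negligible)) => t [Dt /= ht].
apply: contrapT => nE; move: ht; apply/negP; rewrite -leNgt.
have hle N : hN N t <= K ^+ 2.
  by rewrite leNgt; apply/negP => hNt; apply: nE; exists N.
pose g N x := (\sum_i W N i (x, t) * W N i (x, t))%:E.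
have WE N p : \sum_i W N i p * W N i p = (\sum_i V i p * V i p) * \1_(A N) p.
  rewrite mulr_suml; apply: eq_bigr => i _; rewrite /W indicE.
  by case: (_ \in _); rewrite ?mulr1 ?mulr0 ?mul0r.
have V0 p : 0 <= \sum_i V i p * V i p by apply: sumr_ge0 => i _; rewrite -expr2 sqr_ge0.
(* At a fixed point the truncation is inactive once [N] exceeds the sum of the absolute values of
   the components. *)
have glim x : limn (g ^~ x) = (\sum_i V i (x, t) * V i (x, t))%:E.
  apply/cvg_lim => //; apply: cvg_near_cst.
  near=> N; rewrite /g WE indicE mem_set ?mulr1// /A /=.
  near: N; exact: nbhs_infty_ger.
have <- : (\int[P1]_x limn (g ^~ x) = \int[P1]_x (\sum_i V i (x, t) * V i (x, t))%:E)%E.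
  by apply: eq_integral => x _; exact: glim.
have mg N : measurable_fun setT (g N).
  apply/measurable_EFinP; apply: measurable_sum => i.
  have [mW _] := slice_bounded_measurable t (bW N i).
  exact: measurable_funM.
have g0 N x : setT x -> (0 <= g N x)%E.
  by move=> _; rewrite lee_fin sumr_ge0// => i _; rewrite -expr2 sqr_ge0.
have g_nd x : setT x -> {homo g ^~ x : N M / (N <= M)%N >-> (N <= M)%E}.
  move=> _ N M NM; rewrite /g !WE lee_fin ler_wpM2l// !indicE.
  case: (boolP ((x, t) \in A N)) => [/set_mem AN|_]; last by rewrite ler0n.
  by rewrite mem_set//; apply: le_trans AN _; rewrite ler_nat.
have cvgh := @cvg_monotone_convergence _ _ _ P1 _ measurableT _ mg g0 g_nd.
rewrite -(cvg_lim (@ereal_hausdorff R) cvgh); apply: lime_le; first by apply/cvg_ex; eexists; exact: cvgh.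
by apply: nearW => N; rewrite (inner_slice_EFin P1 t (bW N)) lee_fin; exact: hle.
Unshelve. all: by end_near. Qed.

End EssentialBound.

(** * The concrete coefficients, and linearity of the residual in the test function *)

Lemma block_quadratic_form_le0 {R : realFieldType} (k m : nat) (S : 'M[R]_m)
    (v : 'I_(k + m) -> R) :
  (forall w : 'cV[R]_m, w != 0 -> (w^T *m S *m w) 0 0 < 0) ->
  \sum_i (\sum_j v j * (block_mx 0 0 0 S : 'M[R]_(k + m)) j i) * v i <= 0.
Proof.
move=> Sneg; pose c : 'cV[R]_(k + m) := \col_i v i.
have -> : \sum_i (\sum_j v j * (block_mx 0 0 0 S : 'M[R]_(k + m)) j i) * v i =
    (c^T *m block_mx 0 0 0 S *m c) 0 0.
  rewrite mxE; apply: eq_bigr => i _; rewrite !mxE; congr (_ * _).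
  by apply: eq_bigr => j _; rewrite !mxE.
rewrite -(vsubmxK c) tr_col_mx mul_row_block !mulmx0 !add0r mul_row_col mul0mx add0r.
have [->|w0] := eqVneq (dsubmx c) 0; first by rewrite mulmx0 mxE.
exact/ltW/Sneg.
Qed.

Lemma eps_fun_inv_bound {R : realType} (e x : R) : 0 < e -> 0 <= (eps_fun e x)^-1 <= 1 + e^-1.
Proof.
move=> e0; have ei : 0 < e^-1 by rewrite invr_gt0.
by rewrite /eps_fun; case: ifP => _; rewrite ?invr1; apply/andP; split; lra.
Qed.

Lemma measurable_eps_fun_inv {R : realType} (e : R) : measurable_fun setT (fun x => (eps_fun e x)^-1).
Proof.
have -> : (fun x : R => (eps_fun e x)^-1) = (fun x => if x <= 0 then 1 else e^-1).
  by apply/funext => x; rewrite /eps_fun; case: ifP; rewrite ?invr1.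
by apply: measurable_fun_ifT => //; apply: measurable_fun_ler.
Qed.

Lemma weak_form_integrand {R : realType} n (A Q : 'M[R]_n) (kappa : R -> R)
    (phi : 'I_n -> R -> R -> R) (u : 'cV[R]_n) (x t : R) :
  ((\col_i partial_t (phi i) x t)^T *m u) 0 0
  + ((\col_i partial_x (phi i) x t)^T *m A *m u) 0 0
  + kappa x * ((\col_i phi i x t)^T *m Q *m u) 0 0
  = \sum_i residual A Q kappa phi i x t * u i 0.
Proof.
rewrite !mxE mulr_sumr -!big_split; apply: eq_bigr => i _ /=.
rewrite /residual !mxE !mulrDl mulrA; congr (_ + _ * _ + kappa x * _ * _).
  by apply: eq_bigr => j _; rewrite !mxE.
by apply: eq_bigr => j _; rewrite !mxE.
Qed.

Lemma Rintegral_normal_prob_density {R : realType} (f : R -> R) :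
  (forall x, 0 <= f x) -> measurable_fun setT f ->
  Rintegral (normal_prob 0 1) setT f = Rintegral lebesgue_measure setT (fun x => f x * rho x).
Proof.
move=> f0 mf; rewrite /Rintegral; congr fine.
rewrite (integral_normal_prob_density (f := EFin \o f)) //.
exact/measurable_EFinP.
Qed.

Lemma partial_tD {R : realType} (f g : R -> R -> R) x t : smooth2 f -> smooth2 g ->
  partial_t (fun x t => f x t + g x t) x t = partial_t f x t + partial_t g x t.
Proof. by move=> sf sg; have /(congr1 (fun h => h x t)) := iter_partialD [:: true] sf sg. Qed.

Lemma partial_xD {R : realType} (f g : R -> R -> R) x t : smooth2 f -> smooth2 g ->
  partial_x (fun x t => f x t + g x t) x t = partial_x f x t + partial_x g x t.
Proof. by move=> sf sg; have /(congr1 (fun h => h x t)) := iter_partialD [:: false] sf sg. Qed.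

Lemma partial_tZ {R : realType} c (f : R -> R -> R) x t : smooth2 f ->
  partial_t (fun x t => c * f x t) x t = c * partial_t f x t.
Proof. by move=> sf; have /(congr1 (fun h => h x t)) := iter_partialZ [:: true] c sf. Qed.

Lemma partial_xZ {R : realType} c (f : R -> R -> R) x t : smooth2 f ->
  partial_x (fun x t => c * f x t) x t = c * partial_x f x t.
Proof. by move=> sf; have /(congr1 (fun h => h x t)) := iter_partialZ [:: false] c sf. Qed.

Lemma residualD {R : realType} n (A Q : 'M[R]_n) kappa (phi psi : 'I_n -> R -> R -> R) i x t :
  (forall i, smooth2 (phi i)) -> (forall i, smooth2 (psi i)) ->
  residual A Q kappa (fun i x t => phi i x t + psi i x t) i x t =
  residual A Q kappa phi i x t + residual A Q kappa psi i x t.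
Proof.
move=> sphi spsi; rewrite /residual partial_tD//.
under eq_bigr do rewrite partial_xD// mulrDl.
under [in X in _ + X = _]eq_bigr do rewrite mulrDl.
by rewrite !big_split/=; ring.
Qed.

Lemma residualZ {R : realType} n (A Q : 'M[R]_n) kappa c (phi : 'I_n -> R -> R -> R) i x t :
  (forall i, smooth2 (phi i)) ->
  residual A Q kappa (fun i x t => c * phi i x t) i x t = c * residual A Q kappa phi i x t.
Proof.
move=> sphi; rewrite /residual partial_tZ//.
under eq_bigr do rewrite partial_xZ// -mulrA.
under [in X in _ + X = _]eq_bigr do rewrite -mulrA.
by rewrite -!mulr_sumr; ring.
Qed.

(** * The weak solution *)

Section NormalizedResidual.
Context {R : realType} {n : nat}.
Local Notation leb := (@lebesgue_measure R).
Local Notation P := (@normal_prob R 0 1).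
Local Notation D := (`]0, +oo[%classic : set R).
Variables (A Q : 'M[R]_n) (kappa : R -> R) (K : R).
Hypothesis A_sym : A^T = A.
Hypothesis Q_le0 : forall v : 'I_n -> R, \sum_i (\sum_j v j * Q j i) * v i <= 0.
Hypothesis measurable_kappa : measurable_fun setT kappa.
Hypothesis kappa_bound : forall x, 0 <= kappa x <= K.

Definition weight (p : R * R) : R := (Num.sqrt (rho p.1) * rho p.2)^-1.

Lemma continuous_weight : continuous weight.
Proof.
move=> p; apply: cvgV; first by rewrite mulf_neq0 ?rho_neq0// gt_eqF// sqrtr_gt0 rho_gt0.
apply: cvgM.
  apply: (@continuous_comp _ _ _ fst (fun x => Num.sqrt (rho x))); first exact: cvg_fst.
  by apply: continuous_comp; [exact: continuous_rho|exact: sqrt_continuous].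
by apply: (@continuous_comp _ _ _ snd rho); [exact: cvg_snd|exact: continuous_rho].
Qed.

(** What is left of the normalization after integrating against the Gaussian density: the factor by
    which the density [V] is multiplied in [solution]. *)
Lemma weight_rho2 p : weight p * rho2 p = Num.sqrt (rho p.1).
Proof.
have s0 : 0 < Num.sqrt (rho p.1) by rewrite sqrtr_gt0 rho_gt0.
rewrite /weight /rho2 -[X in X * rho p.2](sqr_sqrtr (rho_ge0 p.1)).
by field; rewrite rho_neq0 gt_eqF.
Qed.

(** The indicator confines the pairing to positive times, in agreement with the range of the energy
    estimate. *)
Definition normalized (phi : 'I_n -> R -> R -> R) (i : 'I_n) (p : R * R) : R :=
  residual A Q kappa phi i p.1 p.2 * weight p * \1_D p.2.

Variables (phi : 'I_n -> R -> R -> R) (M : R).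
Hypothesis sphi : forall i, smooth2 (phi i).
Hypothesis phi0 : forall i, supported_in M (phi i).
Local Notation psi := (residual A Q kappa phi).

Lemma normalized_bounded : bounded_family (normalized phi).
Proof.
move=> i; apply: bounded_measurableM.
  split.
    apply: measurable_funM; first exact: residual_measurable.
    exact: continuous2_measurable continuous_weight.
  have [C psiC] := residual_bounded_by_continuous A Q kappa_bound sphi phi0 continuous_weight.
  by exists C => -[x t]; exact: psiC.
have mD : measurable D by [].
have mI : measurable_fun setT (\1_D : R -> R) by exact: measurable_indic.
split; first exact: (measurableT_comp mI measurable_snd).
by exists 1 => p; rewrite indicE; case: (_ \in _); rewrite ?normr1 ?normr0.
Qed.

Let q t := Num.sqrt (inner leb (fun i => psi i ^~ t) (fun i => psi i ^~ t)).

Lemma slice_norm_normalized t : 0 < t -> slice_norm P (normalized phi) t = q t / rho t.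
Proof.
move=> t0; have rt := rho_gt0 t.
rewrite /slice_norm /q.
have -> : inner P (slice (normalized phi) t) (slice (normalized phi) t) =
    (rho t)^-1 ^+ 2 * inner leb (fun i => psi i ^~ t) (fun i => psi i ^~ t).
  rewrite /inner Rintegral_normal_prob_density; last 2 first.
  - by move=> x; apply: sumr_ge0 => i _; rewrite -expr2 sqr_ge0.
  - apply: measurable_sum => i.
    have [mb _] := slice_bounded_measurable t (normalized_bounded i).
    exact: measurable_funM.
  rewrite -RintegralZl//; last first.
    apply: square_integrables_integrable => i;
    exact: (residual_square_integrable A Q measurable_kappa kappa_bound sphi phi0).
  apply: eq_Rintegral => x _; rewrite mulr_suml mulr_sumr; apply: eq_bigr => i _.
  have tD : t \in D by rewrite inE/= in_itv/= t0.
  rewrite /slice /normalized indicE/= tD mulr1 /weight/=.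
  have s0 : 0 < Num.sqrt (rho x) by rewrite sqrtr_gt0 rho_gt0.
  rewrite -[X in _ * X = _](sqr_sqrtr (rho_ge0 x)).
  by field; rewrite rho_neq0 gt_eqF.
rewrite sqrtrM ?sqr_ge0// sqrtr_sqr ger0_norm ?invr_ge0 ?rho_ge0//.
by rewrite mulrC.
Qed.

Lemma mixed_norm_normalized : mixed_norm P P D (normalized phi) = Rintegral leb D q.
Proof.
have [ms _] := slice_norm_bounded P normalized_bounded.
have mD : measurable D by [].
rewrite /mixed_norm Rintegral_mkcond Rintegral_normal_prob_density; last 2 first.
- by move=> t; rewrite patchE; case: ifP => // _; exact: sqrtr_ge0.
- apply/(measurable_restrictT _ mD); exact: (measurable_funS measurableT (@subsetT _ _) ms).
rewrite [RHS]Rintegral_mkcond; apply: eq_Rintegral => t _; rewrite !patchE.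
case: ifPn => [/set_mem|_]; last by rewrite mul0r.
rewrite /= in_itv/= andbT => t0; rewrite -[RHS](divfK (rho_neq0 t)); congr (_ * _).
exact: slice_norm_normalized.
Qed.

(** Cauchy-Schwarz at time 0, followed by the energy estimate for phi(., 0). *)
Lemma initial_pairing_le (u : 'I_n -> R -> R) : square_integrables leb u ->
  `|inner leb (fun i => phi i ^~ 0) u| <=
  Num.sqrt (inner leb u u) * mixed_norm P P D (normalized phi).
Proof.
move=> su; rewrite mixed_norm_normalized.
have sp : square_integrables leb (fun i => phi i ^~ 0).
  by move=> i; apply: test_square_integrable; [exact: sphi|exact: phi0].
apply: le_trans (inner_le_sqrt sp su) _; rewrite mulrC ler_wpM2l ?sqrtr_ge0//.
exact: (energy_estimate A_sym Q_le0 measurable_kappa kappa_bound sphi phi0).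
Qed.

End NormalizedResidual.

Lemma Rintegral_eq_off_null d (T : measurableType d) (R : realType)
    (mu : {measure set T -> \bar R}) (N : set T) (f g : T -> R) :
  measurable N -> mu N = 0%E -> measurable_fun setT f -> measurable_fun setT g ->
  (forall x, ~ N x -> f x = g x) ->
  Rintegral mu setT f = Rintegral mu setT g.
Proof.
move=> mN N0 mf mg fg; congr fine; apply: ae_eq_integral => //.
- exact/measurable_EFinP.
- exact/measurable_EFinP.
by exists N; split => // x /= h; apply: contrapT => Nx; apply: h => _; rewrite fg.
Qed.

Section Existence.
Context {R : realType} {n : nat}.
Local Notation leb := (@lebesgue_measure R).
Local Notation P := (@normal_prob R 0 1).
Local Notation D := (`]0, +oo[%classic : set R).
Variables (A Q : 'M[R]_n) (e : R).
Hypothesis A_sym : A^T = A.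
Hypothesis Q_le0 : forall v : 'I_n -> R, \sum_i (\sum_j v j * Q j i) * v i <= 0.
Hypothesis e_gt0 : 0 < e.
Variable U0 : R -> 'cV[R]_n.
Let u i x := U0 x i 0.
Hypothesis sU0 : square_integrables leb u.

Let kappa x := (eps_fun e x)^-1.
Let kappa_bound x := eps_fun_inv_bound x e_gt0.
Let measurable_kappa := measurable_eps_fun_inv e.
Let K := Num.sqrt (inner leb u u).
Local Notation T := (normalized A Q kappa).

Let initial_integrable (phi : 'I_n -> R -> R -> R) : test_fun2 phi ->
  square_integrables leb (fun i => phi i ^~ 0).
Proof. by move=> [sphi [M phi0]] i; apply: test_square_integrable; [exact: sphi|exact: phi0]. Qed.

Let test_fun2D (phi psi : 'I_n -> R -> R -> R) : test_fun2 phi -> test_fun2 psi ->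
  test_fun2 (fun i x t => phi i x t + psi i x t).
Proof.
move=> [sphi [M phi0]] [spsi [N psi0]]; split; first by move=> i; exact: smooth2D.
exists (Num.max M N) => i x t h; rewrite phi0 ?psi0 ?addr0//.
  by case: h => h; [left|right]; apply: le_lt_trans h; rewrite le_max lexx orbT.
by case: h => h; [left|right]; apply: le_lt_trans h; rewrite le_max lexx.
Qed.

Let test_fun2Z c (phi : 'I_n -> R -> R -> R) : test_fun2 phi ->
  test_fun2 (fun i x t => c * phi i x t).
Proof.
move=> [sphi [M phi0]]; split; first by move=> i; exact: smooth2Z.
by exists M => i x t h; rewrite phi0 ?mulr0.
Qed.

Lemma dual_density : exists V : 'I_n -> R * R -> R, [/\
  forall i, (P \x P)%E.-integrable setT (EFin \o V i),
  forall phi, test_fun2 phi ->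
    \sum_i Rintegral (P \x P)%E setT (fun p => T phi i p * V i p) =
    - inner leb (fun i => phi i ^~ 0) u &
  forall f : 'I_n -> R * R -> R, bounded_family f ->
    \sum_i Rintegral (P \x P)%E setT (fun p => f i p * V i p) <= K * mixed_norm P P D f].
Proof.
(* A relation rather than a function: two test functions may share a normalized residual. The bound
   [Lb], with stability under multiplication by -1, forces their values to agree, so
   well-definedness needs no separate check. *)
pose L : set (('I_n -> R * R -> R^o) * R) := [set a | exists phi, [/\ test_fun2 phi,
  a.1 = T phi & a.2 = - inner leb (fun i => phi i ^~ 0) u]].
have mD : measurable D by [].
have LZ c a : L a -> L (c *: a.1, c * a.2).
  move=> [phi [tphi -> ->]]; exists (fun i x t => c * phi i x t); split.
  - exact: test_fun2Z.
  - apply/funext => i; apply/funext => p; rewrite /normalized residualZ; last by case: tphi.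
    by transitivity (c * (residual A Q kappa phi i p.1 p.2 * weight p * \1_D p.2)); [|rewrite !mulrA].
  - by rewrite /= innerZl ?mulrN//; exact: initial_integrable.
have test0 : test_fun2 (fun (_ : 'I_n) (_ _ : R) => 0 : R).
  split; last by exists 0.
  move=> i s; suff -> : iter_partial s (fun _ _ => 0 : R) = fun _ _ => 0.
    by split; [move=> p; exact: cvg_cst|split => x t; exact: derivable_cst].
  elim: s => //= b s ->; case: b; apply/funext => x; apply/funext => t.
    by rewrite /partial_t derive1E; exact: derive_cst.
  by rewrite /partial_x derive1E; exact: derive_cst.
have LT phi : test_fun2 phi -> L (T phi, - inner leb (fun i => phi i ^~ 0) u).
  by move=> tphi; exists phi.
have L0 : L (0, 0) by have := LZ 0 _ (LT _ test0); rewrite /= scale0r mul0r.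
have LD a b : L a -> L b -> L (a.1 + b.1, a.2 + b.2).
  move=> [phi [tphi -> ->]] [psi [tpsi -> ->]].
  exists (fun i x t => phi i x t + psi i x t); split.
  - exact: test_fun2D.
  - apply/funext => i; apply/funext => p; rewrite /normalized residualD.
    + by rewrite 2!mulrDl.
    + by case: tphi.
    + by case: tpsi.
  - by rewrite /= innerDl ?opprD//; exact: initial_integrable.
have Lb a : L a -> bounded_family a.1 /\ a.2 <= K * mixed_norm P P D a.1.
  move=> [phi [[sphi [M phi0]] -> ->]]; split.
    exact: (normalized_bounded A Q measurable_kappa kappa_bound sphi phi0).
  apply: le_trans (ler_norm _) _; rewrite normrN.
  exact: (initial_pairing_le A_sym Q_le0 measurable_kappa kappa_bound sphi phi0).
have [V [iV VL Vb]] := @mixed_norm_dual _ _ (measurableTypeR R) (measurableTypeR R) R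
  P P D mD n K (sqrtr_ge0 _) L L0 LD LZ Lb.
exists V; split => // phi tphi; exact: (VL _ (LT _ tphi)).
Qed.

Section Solution.
Variable V : 'I_n -> R * R -> R.
Hypothesis iV : forall i, (P \x P)%E.-integrable setT (EFin \o V i).
Hypothesis V_test : forall phi, test_fun2 phi ->
  \sum_i Rintegral (P \x P)%E setT (fun p => T phi i p * V i p) =
  - inner leb (fun i => phi i ^~ 0) u.
Hypothesis V_dual : forall f : 'I_n -> R * R -> R, bounded_family f ->
  \sum_i Rintegral (P \x P)%E setT (fun p => f i p * V i p) <= K * mixed_norm P P D f.

Let mV i : measurable_fun setT (V i).
Proof. by apply/measurable_EFinP; exact: measurable_int (iV i). Qed.

Let slice_energy t : \bar R := (\int[P]_x (\sum_i V i (x, t) * V i (x, t))%:E)%E.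

Let slice_energy_measurable : measurable_fun setT slice_energy.
Proof.
pose F (p : R * R) := (\sum_i V i p * V i p)%:E.
have mF : measurable_fun setT F.
  by apply/measurable_EFinP; apply: measurable_sum => i; exact: measurable_funM.
have F0 p : (0 <= F p)%E by rewrite lee_fin sumr_ge0// => i _; rewrite -expr2 sqr_ge0.
exact: (@measurable_fun_fubini_tonelli_G _ _ (measurableTypeR R) (measurableTypeR R) R P F mF F0).
Qed.

(** The energy bound from duality holds for almost every time only. Setting the solution to 0 at the
    other positive times makes it hold at every one and changes no space-time integral. *)
Definition good_time t := (0 < t) && (slice_energy t <= (K ^+ 2)%:E)%E.

Let good_time_measurable : measurable_fun setT good_time.
Proof.
apply: measurable_and; first exact: measurable_fun_ltr.
exact: measurable_fun_lee.
Qed.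

Definition evolved i (p : R * R) := if good_time p.2 then V i p else 0.

(** The initial value is imposed by hand on the null line t = 0; at negative times [good_time] fails
    and the value is 0. *)
Definition solution (x t : R) : 'cV[R]_n :=
  if t == 0 then U0 x else \col_i (evolved i (x, t) * Num.sqrt (rho x)).

Let evolved_measurable i : measurable_fun setT (evolved i).
Proof.
apply: measurable_fun_ifT => //.
exact: (measurableT_comp good_time_measurable measurable_snd).
Qed.

Let sqrt_rho_measurable : measurable_fun setT (fun p : R * R => Num.sqrt (rho p.1)).
Proof.
have ms : measurable_fun setT (@Num.sqrt R).
  by apply: continuous_measurable_fun; exact: sqrt_continuous.
have mr : measurable_fun setT (fun p : R * R => rho p.1).
  exact: (measurableT_comp measurable_rho measurable_fst).
exact: (measurableT_comp ms mr).
Qed.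

Lemma solution_measurable i : measurable_fun setT (fun p : R * R => solution p.1 p.2 i 0).
Proof.
have -> : (fun p : R * R => solution p.1 p.2 i 0) =
    (fun p => if p.2 == 0 then u i p.1 else evolved i p * Num.sqrt (rho p.1)).
  by apply/funext => -[x t]; rewrite /solution /=; case: ifP => _ //; rewrite mxE.
apply: measurable_fun_ifT.
- by apply: measurable_fun_eqr => //; exact: measurable_snd.
- have [mu _] := sU0 i; exact: (measurableT_comp mu measurable_fst).
- exact: measurable_funM.
Qed.

Lemma L2sq_initial : L2sq U0 = (K ^+ 2)%:E.
Proof.
rewrite /K sqr_sqrtr ?inner_ge0// /inner /Rintegral fineK.
  by apply: eq_integral => x _; congr EFin; apply: eq_bigr => i _; rewrite expr2.
apply: (@integrable_fin_num _ _ _ leb setT measurableT).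
by have := square_integrables_integrable sU0 sU0.
Qed.

Lemma solution_L2sq t : 0 < t -> (L2sq (solution ^~ t) <= L2sq (solution ^~ 0%R))%E.
Proof.
move=> t0; have -> : solution ^~ 0 = U0 by apply/funext => x; rewrite /solution eqxx.
rewrite L2sq_initial /L2sq.
(* At a bad time the solution is 0. At a good one the squared factor sqrt (rho x) is the Gaussian
   density, so the Lebesgue energy equals [slice_energy t]. *)
have [gt|bad] := boolP (good_time t); last first.
  rewrite integral0_eq; first by rewrite lee_fin sqr_ge0.
  move=> x _; rewrite big1// => i _.
  by rewrite /solution gt_eqF// mxE /evolved/= (negbTE bad) mul0r expr0n.
have /andP[_ ht] := gt; apply: le_trans ht; rewrite /slice_energy.
rewrite (integral_normal_prob_density (f := fun x => (\sum_i V i (x, t) * V i (x, t))%:E)).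
- rewrite le_eqVlt; apply/orP; left; apply/eqP; apply: eq_integral => x _.
  rewrite -EFinM mulr_suml; congr EFin; apply: eq_bigr => i _.
  by rewrite /solution gt_eqF// mxE /evolved/= gt exprMn sqr_sqrtr ?rho_ge0// expr2.
- by move=> x; rewrite lee_fin sumr_ge0// => i _; rewrite -expr2 sqr_ge0.
- apply/measurable_EFinP; apply: measurable_sum => i.
  by apply: measurable_funM; exact: (measurable_fun_pair1 t (mV i)).
Qed.

Local Notation RR := (measurableTypeR R * measurableTypeR R)%type.

Let line0 : set RR := setT `*` [set 0].

Let line0_measurable : measurable line0.
Proof. exact: measurableX. Qed.

Let line0_null : (leb \x leb)%E line0 = 0%E.
Proof.
rewrite /line0 product_measure1E// [X in (_ * X)%E](_ : _ = 0%E) ?mule0//.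
exact: lebesgue_measure_set1.
Qed.

Let evolved_integrable i : (P \x P)%E.-integrable setT (EFin \o evolved i).
Proof.
apply: (le_integrable measurableT _ _ (iV i)); first by apply/measurable_EFinP; exact: evolved_measurable.
by move=> p _ /=; rewrite lee_fin /evolved; case: ifP => // _; rewrite normr0.
Qed.

(** Off the line t = 0 the factor sqrt (rho x) is [weight] times [rho2]: [weight] is bounded on the
    box, and [evolved] times [rho2] is Lebesgue integrable because [V] is integrable for the
    Gaussian measure. *)
Lemma solution_loc_integrable : loc_integrable_half solution.
Proof.
split; first exact: solution_measurable.
move=> M i; set B := (X in integrable _ X _).
have mB : measurable (B : set RR).
  apply: measurableX.
    have -> : [set x : R | `|x| <= M] = `[- M, M]%classic.
      by apply/seteqP; split => x; rewrite /= in_itv/= ler_norml.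
    exact: measurable_itv.
  have -> : [set t : R | 0 <= t <= M] = `[0, M]%classic.
    by apply/seteqP; split => x; rewrite /= in_itv/=.
  exact: measurable_itv.
have msol : measurable_fun (B : set RR) (fun p : RR => (solution p.1 p.2 i 0)%:E).
  by apply/measurable_EFinP; apply: measurable_funTS; exact: solution_measurable.
apply/(negligible_integrable line0_measurable mB msol line0_null).
have mBN : measurable (B `\` line0 : set RR) by exact: measurableD.
have [C wC] := continuous2_bounded_on_box M (@continuous_weight R).
have [iE _] := Rintegral_normal_prob_density2 (evolved_integrable i).
have iEB : (leb \x leb)%E.-integrable (B `\` line0) (EFin \o (fun p => evolved i p * rho2 p)).
  exact: integrableS iE.
apply: (le_integrable mBN _ _ (integrableZl mBN C iEB)).
  exact: measurable_funS msol.
move=> [x t] [[/= xM /andP[t0 tM]] tN] /=; rewrite lee_fin.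
have tneq0 : t == 0 = false by apply/negP => /eqP tE; apply: tN.
rewrite /solution tneq0 mxE -[Num.sqrt _](weight_rho2 (x, t)) mulrCA mulrC normrM.
rewrite [leRHS]normrM mulrC ler_wpM2r//.
by apply: le_trans (wC x t xM _) (ler_norm _); rewrite ger0_norm.
Qed.

Let bad_time : set (measurableTypeR R) := D `&` [set t | ((K ^+ 2)%:E < slice_energy t)%E].

Let bad_time_measurable : measurable bad_time.
Proof.
have mD : measurable (D : set (measurableTypeR R)) by [].
apply: measurableI => //.
have -> : [set t | ((K ^+ 2)%:E < slice_energy t)%E] =
    setT `&` slice_energy @^-1` `](K ^+ 2)%:E, +oo[.
  by rewrite setTI; apply/seteqP; split => t; rewrite /= in_itv/= ?andbT// => /andP[].
by apply: slice_energy_measurable; [exact: measurableT|exact: emeasurable_itv].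
Qed.

Let bad_time_null : P bad_time = 0%E.
Proof.
have mD : measurable (D : set (measurableTypeR R)) by [].
have := @essential_slice_bound _ _ (measurableTypeR R) (measurableTypeR R) R P P D mD n K
  (sqrtr_ge0 _) V iV V_dual.
by move/(negligibleP _ bad_time_measurable).
Qed.

(** Three changes, each harmless: the solution becomes [evolved] times sqrt (rho x) off the line t =
    0, Lebesgue measure becomes Gaussian measure, and [evolved] becomes [V] off the null set of bad
    times. *)
Let space_time_integral phi : test_fun2 phi ->
  Rintegral (leb \x leb)%E (setT `*` [set t | 0 <= t])
    (fun p => \sum_i residual A Q kappa phi i p.1 p.2 * solution p.1 p.2 i 0) =
  \sum_i Rintegral (P \x P)%E setT (fun p => T phi i p * V i p).
Proof.
move=> [sphi [M phi0]].
have bT : bounded_family (T phi).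
  exact: (normalized_bounded A Q measurable_kappa kappa_bound sphi phi0).
have mT i : measurable_fun setT (T phi i) by case: (bT i).
have mH : measurable (setT `*` [set t | 0 <= t] : set RR).
  apply: measurableX => //; have -> : [set t : R | 0 <= t] = `[0, +oo[%classic.
    by apply/seteqP; split => t; rewrite /= in_itv/= andbT.
  exact: measurable_itv.
transitivity (Rintegral (leb \x leb)%E setT (fun p => (\sum_i T phi i p * evolved i p) * rho2 p)).
  rewrite Rintegral_mkcond; apply: (Rintegral_eq_off_null line0_measurable line0_null).
  - apply/(measurable_restrictT _ mH); apply: measurable_funTS.
    apply: measurable_sum => i; apply: measurable_funM; last exact: solution_measurable.
    exact: residual_measurable.
  - apply: measurable_funM; last exact: measurable_rho2.
    by apply: measurable_sum => i; apply: measurable_funM; [exact: mT|exact: evolved_measurable].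
  - move=> [x t] tN; rewrite patchE.
    have t0 : t == 0 = false by apply/negP => /eqP tE; apply: tN.
    rewrite mulr_suml; case: ifPn => [/set_mem[_ /= t_ge0]|/negP tneg].
      apply: eq_bigr => i _; rewrite /solution t0 mxE -[Num.sqrt _](weight_rho2 (x, t)).
      have tD : t \in D by rewrite inE/= in_itv/= lt_neqAle eq_sym t0 t_ge0.
      by rewrite /normalized indicE/= tD mulr1 /=; ring.
    rewrite big1// => i _; rewrite /normalized indicE/=.
    case: (boolP (t \in D)) => [/set_mem|_]; last by rewrite !mulr0 !mul0r.
    rewrite /= in_itv/= andbT => tpos; case: tneg.
    by rewrite inE; split => //=; exact: ltW.
have iTE i : (P \x P)%E.-integrable setT (EFin \o (fun p => T phi i p * evolved i p)).
  exact: (@bounded_measurable_integrableM _ RR R (P \x P)%E _ _ (bT i) (evolved_integrable i)).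
have iS : (P \x P)%E.-integrable setT (EFin \o (fun p => \sum_i T phi i p * evolved i p)).
  have := integrable_sum measurableT (index_enum 'I_n) (fun i (_ : xpredT i) => iTE i).
  by apply: eq_integrable => // x _ /=; rewrite sumEFin.
have [_ <-] := Rintegral_normal_prob_density2 iS.
rewrite -(Rintegral_sum _ iTE); apply: eq_bigr => i _.
have mbad : measurable (setT `*` bad_time : set RR).
  by apply: measurableX => //; exact: bad_time_measurable.
have bad0 : (P \x P)%E (setT `*` bad_time) = 0%E.
  rewrite (product_measure1E _ _ measurableT bad_time_measurable).
  by rewrite [X in (_ * X)%E](_ : _ = 0%E) ?mule0//; exact: bad_time_null.
apply: (Rintegral_eq_off_null mbad bad0).
- by apply: measurable_funM; [exact: mT|exact: evolved_measurable].
- by apply: measurable_funM; [exact: mT|exact: mV].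
(* [evolved] and [V] may also differ at nonpositive times, but there the indicator in [normalized]
   is 0. *)
- move=> [x t] tN; rewrite /evolved /=; case: ifPn => // tbad.
  rewrite /normalized indicE/=; case: (boolP (t \in D)) => [/set_mem tD|_]; last by rewrite !mulr0 !mul0r.
  case: tN; split => //=; split => //=.
  move: tbad; rewrite /good_time negb_and -leNgt -ltNge => /orP[|//].
  by move: tD; rewrite /= in_itv/= andbT ltNge => /negbTE ->.
Qed.

Lemma solution_weak : weak_solution A Q (eps_fun e) U0 solution.
Proof.
split; first exact: solution_loc_integrable.
split; first by move=> x; rewrite /solution eqxx.
move=> phi tphi.
have -> : Rintegral leb setT (fun x => ((\col_i phi i x 0)^T *m U0 x) 0 0) =
    inner leb (fun i => phi i ^~ 0) u.
  by apply: eq_Rintegral => x _; rewrite mxE; apply: eq_bigr => i _; rewrite !mxE.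
apply/eqP; rewrite addr_eq0 -(V_test tphi) -(space_time_integral tphi); apply/eqP.
by apply: eq_Rintegral => p _ /=; exact: weak_form_integrand.
Qed.

End Solution.

End Existence.

Lemma sq_integrable_square_integrable {R : realType} (f : R -> R) :
  sq_integrable f -> square_integrable (@lebesgue_measure R) f.
Proof.
move=> [mf f2]; split => //; apply/integrableP; split.
  by apply/measurable_EFinP; exact: measurable_funX.
by under eq_integral do rewrite /= ger0_norm ?sqr_ge0//.
Qed.

Theorem theorem2p2 (R : realType) (k m : nat)
  (A : 'M[R]_(k + m)) (S : 'M[R]_m) (Q : 'M[R]_(k + m))
  (hAsym : A^T = A)
  (hSsym : S^T = S)
  (hSneg : forall v : 'cV[R]_m, v != 0 -> (v^T *m S *m v) 0 0 < 0)
  (hQ : Q = block_mx 0 0 0 S)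
  (hdet : \det A != 0)
  (U0 : R -> 'cV[R]_(k + m)) (hU0 : H1vec U0) :
  forall e : R, 0 < e ->
    exists U : R -> R -> 'cV[R]_(k + m),
      weak_solution A Q (eps_fun e) U0 U /\
      forall t : R, 0 < t ->
        (L2sq (fun x => U x t) <= L2sq (fun x => U x 0%R))%E.
Proof.
move=> e e0.
have Q_le0 (v : 'I_(k + m) -> R) : \sum_i (\sum_j v j * Q j i) * v i <= 0.
  by rewrite hQ; exact: block_quadratic_form_le0.
have sU0 : square_integrables (@lebesgue_measure R) (fun i x => U0 x i 0).
  by move=> i; apply: sq_integrable_square_integrable; case: (hU0 i).
have [V [iV V_test V_dual]] := dual_density hAsym Q_le0 e0 sU0.
exists (solution U0 V); split.
  exact: (solution_weak e0 sU0 iV V_test V_dual).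
by move=> t; exact: (solution_L2sq sU0 iV).
Qed.
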